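(* Let $n\in\mathbb{N}$, $n\geq 2$, let $p,q\in[1,\infty]$ and $r\in(2,\infty]$. Then there is no Strichartz estimate $$\|e^{it\Delta}\phi\|_{L^p_t(\mathbb{R};L^q(\mathbb{R}^n))}\lesssim \|\phi\|_{L^r(\mathbb{R}^n)},$$ i.e. there is no constant $C>0$ such that $\|e^{it\Delta}\phi\|_{L^p_t(\mathbb{R};L^q(\mathbb{R}^n))}\leq C\|\phi\|_{L^r(\mathbb{R}^n)}$ holds for all $\phi\in L^r(\mathbb{R}^n)$.
   Context: $e^{it\Delta}$ denotes the free Schrödinger propagator, so that $\psi(\cdot,t)=e^{it\Delta}\phi$ is the solution of $i\partial_t\psi+\Delta\psi=0$ in $\mathbb{R}^n$, $\psi(0)=\phi$. It is the Fourier multiplier with symbol $e^{-it|\xi|^2}$, acting on tempered distributions (in particular on $L^r(\mathbb{R}^n)$). The norm is $\|\psi\|_{L^p_t(\mathbb{R};L^q(\mathbb{R}^n))}=\big\|\,t\mapsto\|\psi(\cdot,t)\|_{L^q(\mathbb{R}^n)}\big\|_{L^p(\mathbb{R})}$, understood as $+\infty$ if $\psi$ does not belong to $L^p(\mathbb{R};L^q(\mathbb{R}^n))$. *)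

(* Defs.v *)
From HB Require Import structures.
From mathcomp Require Import all_boot all_order all_algebra.
From mathcomp Require Import all_classical all_reals all_analysis.
From mathcomp Require Import complex.

Set Implicit Arguments.
Unset Strict Implicit.
Unset Printing Implicit Defensive.
Import Order.TTheory GRing.Theory Num.Theory.
Import numFieldNormedType.Exports.

Local Open Scope classical_set_scope.
Local Open Scope ring_scope.

(* R^n is 'rV[R]_n, with the sigma-algebra generated by the coordinates,
   i.e. the Borel sigma-algebra. *)
Section rV_measurable.
Variables (R : realType) (n : nat).

Definition rV_cylinder : set (set 'rV[R]_n) :=
  [set A : set 'rV[R]_n | exists (i : 'I_n) (B : set R),
    measurable B /\ A = (fun x : 'rV[R]_n => x ord0 i) @^-1` B].

HB.instance Definition _ := @isMeasurable.Build (sigma_display rV_cylinder)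
  'rV[R]_n <<s rV_cylinder >> (@sigma_algebra0 _ setT rV_cylinder)
  (@sigma_algebraC _ rV_cylinder) (@sigma_algebra_bigcup _ setT rV_cylinder).

Lemma measurable_rV_coord (i : 'I_n) :
  measurable_fun [set: 'rV[R]_n] (fun x : 'rV[R]_n => x ord0 i).
Proof.
by move=> _ B mB; rewrite setTI; apply: sub_sigma_algebra; exists i, B.
Qed.

Lemma measurable_rVP d (T : measurableType d) (f : T -> 'rV[R]_n) :
  (forall i, measurable_fun [set: T] (fun x => f x ord0 i)) ->
  measurable_fun [set: T] f.
Proof.
move=> mf _ Y mY; rewrite setTI.
suff : <<s rV_cylinder >> `<=` image_set_system setT f measurable.
  by move=> /(_ Y mY); rewrite /image_set_system/= setTI.
apply: smallest_sub.
  exact/sigma_algebra_image/sigma_algebra_measurable.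
move=> A [i [B [mB ->]]]; rewrite /image_set_system/=.
exact: (mf i measurableT B mB).
Qed.

End rV_measurable.

(* Lebesgue measure on R^n, by recursion on n: the image of the product of the
   Lebesgue measures of R and R^n under R * R^n -> R^(n+1). *)
Section lebesgue_rV.
Variable R : realType.

Definition rV_cons n (x : R * 'rV[R]_n) : 'rV[R]_n.+1 := row_mx x.1%:M x.2.

Definition rV_uncons n (x : 'rV[R]_n.+1) : R * 'rV[R]_n :=
  (x ord0 ord0, \row_i x ord0 (lift ord0 i)).

Lemma rV_cons0 n (x : R * 'rV[R]_n) : rV_cons x ord0 ord0 = x.1.
Proof.
transitivity (row_mx x.1%:M x.2 ord0 (@lshift 1 n ord0)).
  by congr (_ _ _); exact: val_inj.
by rewrite row_mxEl mxE eqxx mulr1n.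
Qed.

Lemma rV_consS n (x : R * 'rV[R]_n) i :
  rV_cons x ord0 (lift ord0 i) = x.2 ord0 i.
Proof.
transitivity (row_mx (x.1%:M : 'M[R]_1) x.2 ord0 (@rshift 1 n i)).
  by congr (_ _ _); exact: val_inj.
by rewrite row_mxEr.
Qed.

Lemma rV_consK n : cancel (@rV_cons n) (@rV_uncons n).
Proof.
move=> x; rewrite /rV_uncons rV_cons0 [RHS]surjective_pairing; congr pair.
by apply/rowP => i; rewrite mxE rV_consS.
Qed.

Lemma measurable_rV_cons n : measurable_fun [set: R * 'rV[R]_n] (@rV_cons n).
Proof.
apply: measurable_rVP => i; case: (unliftP ord0 i) => [j ->|->].
  under eq_fun do rewrite rV_consS.
  exact: measurableT_comp (measurable_rV_coord j) measurable_snd.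
under eq_fun do rewrite rV_cons0.
exact: measurable_fst.
Qed.

Lemma measurable_rV_uncons n :
  measurable_fun [set: 'rV[R]_n.+1] (@rV_uncons n).
Proof.
apply: measurable_fun_pair; first exact: measurable_rV_coord.
apply: measurable_rVP => i.
under eq_fun do rewrite mxE.
exact: measurable_rV_coord.
Qed.

Section step.
Variables (n : nat) (mu : {sigma_finite_measure set 'rV[R]_n -> \bar R}).

Definition lebesgue_rVS : set 'rV[R]_n.+1 -> \bar R :=
  pushforward (@lebesgue_measure R \x mu)%E (@rV_cons n).

Let lebesgue_rVS0 : lebesgue_rVS set0 = 0%E.
Proof. by rewrite /lebesgue_rVS /pushforward preimage_set0 measure0. Qed.

Let lebesgue_rVS_ge0 A : (0 <= lebesgue_rVS A)%E.
Proof. by rewrite /lebesgue_rVS /pushforward measure_ge0. Qed.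

Let lebesgue_rVS_sigma_additive : semi_sigma_additive lebesgue_rVS.
Proof.
have mf := @measurable_rV_cons n.
by apply: measure_semi_sigma_additive.
Qed.

HB.instance Definition _ := isMeasure.Build _ _ _ lebesgue_rVS
  lebesgue_rVS0 lebesgue_rVS_ge0 lebesgue_rVS_sigma_additive.

Let lebesgue_rVS_sigma_finite : sigma_finite setT lebesgue_rVS.
Proof.
have /sigma_finiteP[F [TF ndF Foo]] := sigma_finiteT (@lebesgue_measure R).
have /sigma_finiteP[G [TG ndG Goo]] := sigma_finiteT mu.
exists (fun k => @rV_uncons n @^-1` (F k `*` G k)).
  rewrite -preimage_bigcup; apply/esym/seteqP; split => // x _.
  have [i _ Fi] : (\bigcup_i F i) (rV_uncons x).1 by rewrite -TF.
  have [j _ Gj] : (\bigcup_j G j) (rV_uncons x).2 by rewrite -TG.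
  have /subsetPset FF := ndF _ _ (leq_maxl i j).
  have /subsetPset GG := ndG _ _ (leq_maxr i j).
  by exists (maxn i j) => //; split; [exact: FF | exact: GG].
move=> k; have [mF Fk] := Foo k; have [mG Gk] := Goo k; split.
  rewrite -[X in measurable X]setTI; apply: measurable_rV_uncons => //.
  exact: measurableX.
rewrite /lebesgue_rVS /pushforward -comp_preimage.
rewrite (_ : _ \o _ = id) ?preimage_id; last exact/funext/rV_consK.
by rewrite product_measure1E// lte_mul_pinfty// ge0_fin_numE.
Qed.

HB.instance Definition _ := Measure_isSigmaFinite.Build _ _ _ lebesgue_rVS
  lebesgue_rVS_sigma_finite.

End step.

Fixpoint lebesgue_rV n : {sigma_finite_measure set 'rV[R]_n -> \bar R} :=
  if n is m.+1 then lebesgue_rVS (lebesgue_rV m) else \d_(0 : 'rV[R]_0).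

End lebesgue_rV.

Local Notation Re := complex.Re.
Local Notation Im := complex.Im.
Local Notation normc := ComplexField.Normc.normc.

Section complex_functions.
Variables (R : realType) (n : nat).
Implicit Types (f eta : 'rV[R]_n -> R[i]) (q : \bar R).

Definition integral_rV f : R[i] :=
  Complex (\int[lebesgue_rV R n]_x Re (f x)) (\int[lebesgue_rV R n]_x Im (f x)).

Definition Lnorm_rV q f : \bar R :=
  Lnorm (lebesgue_rV R n) q (fun x => (normc (f x))%:E).

Definition Lfun_rV q f : Prop :=
  [/\ measurable_fun setT (fun x => Re (f x)),
      measurable_fun setT (fun x => Im (f x)) &
      (Lnorm_rV q f < +oo)%E].

Definition partial_rV (s : seq 'I_n) (f : 'rV[R]_n -> R) : 'rV[R]_n -> R :=
  foldr (fun i (h : 'rV[R]_n -> R) => 'D_(delta_mx ord0 i) h) f s.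

(* `|x| is the sup norm of R^n, which is equivalent to the Euclidean one. *)
Definition schwartz_real (f : 'rV[R]_n -> R) : Prop :=
  (forall s x, differentiable (partial_rV s f) x) /\
  (forall s k, exists M : R, forall x, `|x| ^+ k * `|partial_rV s f x| <= M).

Definition schwartz f : Prop :=
  schwartz_real (fun x => Re (f x)) /\ schwartz_real (fun x => Im (f x)).

Definition dot_rV (x y : 'rV[R]_n) : R := \sum_(i < n) x ord0 i * y ord0 i.

Definition expi (theta : R) : R[i] := Complex (cos theta) (sin theta).

Definition fourier f (xi : 'rV[R]_n) : R[i] :=
  integral_rV (fun x => expi (- dot_rV x xi) * f x).

Definition inv_fourier f (x : 'rV[R]_n) : R[i] :=
  real_complex R ((2 * pi) ^- n) *
  integral_rV (fun xi => expi (dot_rV x xi) * f xi).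

(* A tempered distribution is encoded by a functional on all functions, of
   which only the values on Schwartz functions are meaningful. *)
Definition tempered : Type := ('rV[R]_n -> R[i]) -> R[i].

Definition tempered_of f : tempered :=
  fun eta => integral_rV (fun x => f x * eta x).

Definition tempered_eq (T U : tempered) : Prop :=
  forall eta, schwartz eta -> T eta = U eta.

Definition tempered_fourier (T : tempered) : tempered :=
  fun eta => T (fourier eta).

Definition tempered_inv_fourier (T : tempered) : tempered :=
  fun eta => T (inv_fourier eta).

Definition tempered_mul (m : 'rV[R]_n -> R[i]) (T : tempered) : tempered :=
  fun eta => T (fun xi => m xi * eta xi).

Definition schrodinger_propagator (t : R) (T : tempered) : tempered :=
  tempered_inv_fourier
    (tempered_mul (fun xi => expi (- (t * dot_rV xi xi))) (tempered_fourier T)).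

End complex_functions.

Section Bochner.
Variables (R : realType) (n : nat).
Implicit Types (p q : \bar R) (psi : R -> 'rV[R]_n -> R[i]).

Definition simple_Lfun q psi : Prop :=
  exists (m : nat) (A : 'I_m -> set R) (g : 'I_m -> 'rV[R]_n -> R[i]),
    [/\ forall j, measurable (A j), forall j, Lfun_rV q (g j) &
        forall t x, psi t x = \sum_(j < m) real_complex R (\1_(A j) t) * g j x].

(* Strong (Bochner) measurability of t |-> psi t, as a map into L^q(R^n). *)
Definition strongly_measurable q psi : Prop :=
  exists s : nat -> R -> 'rV[R]_n -> R[i],
    (forall k, simple_Lfun q (s k)) /\
    {ae @lebesgue_measure R, forall t,
      Lnorm_rV q (fun x => psi t x - s k t x) @[k --> \oo] --> 0%E}.

Definition mixed_norm p q psi : \bar R :=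
  Lnorm (@lebesgue_measure R) p (fun t => Lnorm_rV q (psi t)).

Definition mixed_Lfun p q psi : Prop :=
  [/\ {ae @lebesgue_measure R, forall t, Lfun_rV q (psi t)},
      strongly_measurable q psi & (mixed_norm p q psi < +oo)%E].

(* The L^p(R; L^q(R^n)) norm of a time-dependent tempered distribution: it does
   not depend on the representative psi, and is +oo (the infimum of set0) if
   there is none in L^p(R; L^q(R^n)). *)
Definition tempered_mixed_norm p q (u : R -> tempered R n) : \bar R :=
  ereal_inf [set mixed_norm p q psi | psi in
    [set psi | mixed_Lfun p q psi /\
      {ae @lebesgue_measure R, forall t,
        tempered_eq (tempered_of (psi t)) (u t)}]].

End Bochner.

(* Main.v *)
Require Import Defs.
From mathcomp Require Import all_boot all_order all_algebra.
From mathcomp Require Import all_classical all_reals all_analysis.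
From mathcomp Require Import measurable_realfun ess_sup_inf complex ring lra.

(** A wave that spreads out so as to lose $L^r$ norm, $r > 2$, can be run
    backwards: with $S = |1 - is|$, the datum
    $\phi_s(x) = e^{-|x|^2 / (4(1 - is))}$ is a wide chirped Gaussian, of
    modulus $e^{-|x|^2/(4S^2)}$, that focuses at time $s$ to a multiple of
    $e^{-|x|^2/4}$ of modulus $S^{n/2}$.  Near time $s$ the solution thus keeps
    a norm of order $S^{n/2}$ in every $L^q$, for a unit of time, so that its
    $L^p_t L^q_x$ norm is at least $c S^{n/2}$ whatever $p$ and $q$ are.  The
    datum only has $\|\phi_s\|_r = D S^{n/r}$, and $n/r < n/2$.  Letting
    $s \to \infty$ rules out any constant.

    The lower bound is a duality argument, so the solution is never identified
    as a function.  The propagator is defined by transposition; for any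
    representative $\psi$ of the solution and almost every $t$,
    $\int \psi_t \eta$ is therefore $\int \phi_s \, e^{it\Delta} \eta$, for the
    single Schwartz function $\eta = e^{-|x|^2/4}$ ([schwartz_gauss]).
    Everything under this integral is a Gaussian of complex width, and its
    modulus is computed exactly ([schrodinger_pairing],
    [focusing_pairing_ge]).  Hoelder's inequality against $\eta$
    ([integral_weight_le]) turns it into a lower bound of $\|\psi_t\|_q$
    for almost every $t \in [s, s + 1]$, and [Lnorm_ge_cst] integrates in time;
    see [tempered_mixed_norm_focusing_ge].  The upper bound is
    [Lnorm_focusing_le].

    All these integrals factor over the coordinates ([cintegrable_rV_prod]), so
    the analysis is that of $F(w, x) = \int_{\mathbb R} e^{-wy^2 - ixy} dy$ for
    $\mathrm{Re}\, w > 0$.  Differentiating under the integral and integrating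
    by parts gives linear differential equations in $x$ and in
    $\mathrm{Im}\, w$, whose solutions are
    $F(w, x) = F(w, 0) e^{-x^2/(4w)}$ ([gauss_intE]) and $w F(w, 0)^2 = \pi$
    ([sqr_gauss_int0]). *)

Set Implicit Arguments.
Unset Strict Implicit.
Unset Printing Implicit Defensive.
Import Order.TTheory GRing.Theory Num.Theory.
Import numFieldNormedType.Exports.
Local Open Scope classical_set_scope.
Local Open Scope ring_scope.
Local Notation Re := complex.Re.
Local Notation Im := complex.Im.
Local Notation normc := ComplexField.Normc.normc.

(** * Parts and moduli of complex numbers *)

Section complex_parts.
Variable R : realType.
Implicit Types z w : R[i].

Lemma ReM z w : Re (z * w) = Re z * Re w - Im z * Im w.
Proof. by case: z; case: w. Qed.

Lemma ImM z w : Im (z * w) = Re z * Im w + Im z * Re w.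
Proof. by case: z; case: w. Qed.

Lemma ReD z w : Re (z + w) = Re z + Re w.
Proof. by case: z; case: w. Qed.

Lemma ImD z w : Im (z + w) = Im z + Im w.
Proof. by case: z; case: w. Qed.

Lemma ReN z : Re (- z) = - Re z.
Proof. by case: z. Qed.

Lemma complex_ext z w : Re z = Re w -> Im z = Im w -> z = w.
Proof. by case: z w => [? ?] [? ?] /= -> ->. Qed.

Lemma normc_ge0 z : 0 <= normc z.
Proof. by case: z => a b; exact: sqrtr_ge0. Qed.

Lemma sqr_normc z : normc z ^+ 2 = Re z ^+ 2 + Im z ^+ 2.
Proof. by case: z => a b /=; rewrite sqr_sqrtr// addr_ge0// sqr_ge0. Qed.

Lemma normc_real (a : R) : normc (real_complex R a) = `|a|.
Proof. by rewrite /= expr0n addr0 sqrtr_sqr. Qed.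

Lemma ler_Re_normc z : `|Re z| <= normc z.
Proof.
rewrite -(@ler_pXn2r _ 2) ?nnegrE ?normc_ge0//.
by rewrite sqr_normc real_normK ?num_real// lerDl sqr_ge0.
Qed.

Lemma ler_Im_normc z : `|Im z| <= normc z.
Proof.
rewrite -(@ler_pXn2r _ 2) ?nnegrE ?normc_ge0//.
by rewrite sqr_normc real_normK ?num_real// lerDr sqr_ge0.
Qed.

(** The rotation $c = \bar z / |z|$ lets a bound of real parts control a
    modulus. *)
Lemma normc_rotation z : exists2 c, normc c = 1 & Re (c * z) = normc z.
Proof.
have [z0|z0] := eqVneq (normc z) 0.
  exists 1; first exact: ComplexField.Normc.normc1.
  by rewrite mul1r z0 (ComplexField.Normc.eq0_normc z0).
have N2 := sqr_normc z.
move: (normc z) z0 N2 (normc_ge0 z) => N N0 N2 Nge0.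
exists (Complex (Re z / N) (- Im z / N)).
  apply/eqP; rewrite -(@eqrXn2 _ 2) ?normc_ge0// sqr_normc; apply/eqP.
  change ((Re z / N) ^+ 2 + (- Im z / N) ^+ 2 = 1 ^+ 2).
  by rewrite !expr_div_n sqrrN -mulrDl -N2 divff ?expr1n// expf_eq0.
rewrite ReM; change (Re z / N * Re z - (- Im z / N) * Im z = N).
by apply: (mulIf N0); rewrite -expr2 N2; field.
Qed.

Lemma normcX z k : normc (z ^+ k) = normc z ^+ k.
Proof.
elim: k => [|k IH]; first by rewrite !expr0 ComplexField.Normc.normc1.
by rewrite !exprS ComplexField.Normc.normcM IH.
Qed.

Lemma normc_prod (I : Type) (s : seq I) (F : I -> R[i]) :
  normc (\prod_(i <- s) F i) = \prod_(i <- s) normc (F i).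
Proof.
elim: s => [|i s IH]; first by rewrite !big_nil ComplexField.Normc.normc1.
by rewrite !big_cons ComplexField.Normc.normcM IH.
Qed.

End complex_parts.

(** * Integrals of complex-valued functions *)

Section complex_integral.
Context d (T : measurableType d) (R : realType).
Variable mu : {measure set T -> \bar R}.
Implicit Types (f g : T -> R[i]) (c : R[i]).

Definition cmeasurable f :=
  measurable_fun setT (fun x => Re (f x)) /\
  measurable_fun setT (fun x => Im (f x)).

Definition cintegrable f :=
  mu.-integrable setT (fun x => (Re (f x))%:E) /\
  mu.-integrable setT (fun x => (Im (f x))%:E).

Definition cintegral f : R[i] :=
  Complex (\int[mu]_x Re (f x)) (\int[mu]_x Im (f x)).

Lemma cmeasurableM f g :
  cmeasurable f -> cmeasurable g -> cmeasurable (fun x => f x * g x).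
Proof.
move=> [rf imf] [rg img]; split.
- under eq_fun do rewrite ReM.
  by apply: measurable_funB; exact: measurable_funM.
- under eq_fun do rewrite ImM.
  by apply: measurable_funD; exact: measurable_funM.
Qed.

Lemma cmeasurable_real (h : T -> R) :
  measurable_fun setT h -> cmeasurable (fun x => real_complex R (h x)).
Proof. by move=> mh; split => //=; exact: measurable_cst. Qed.

Lemma cmeasurable_cst c : cmeasurable (fun=> c).
Proof. by split; exact: measurable_cst. Qed.

Lemma measurable_normc f :
  cmeasurable f -> measurable_fun setT (fun x => normc (f x)).
Proof.
move=> [mr mi].
rewrite (_ : (fun x => normc _) =
    (fun x => Num.sqrt (Re (f x) ^+ 2 + Im (f x) ^+ 2))); last first.
  by apply/funext => x; case: (f x).
apply: (@measurableT_comp _ _ _ _ _ _ (@Num.sqrt R : R -> R)).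
  by apply: continuous_measurable_fun; exact: sqrt_continuous.
by apply: measurable_funD; exact: measurable_funX.
Qed.

Lemma cintegrable_cmeasurable f : cintegrable f -> cmeasurable f.
Proof.
by move=> [/measurable_int/measurable_EFinP ? /measurable_int/measurable_EFinP].
Qed.

Lemma cintegrable_dominated f (h : T -> R) :
  cmeasurable f -> mu.-integrable setT (fun x => (h x)%:E) ->
  (forall x, normc (f x) <= h x) -> cintegrable f.
Proof.
move=> [mr mi] ih fh; split; apply: le_integrable ih => //.
- exact/measurable_EFinP.
- move=> x _; rewrite /= lee_fin (le_trans (ler_Re_normc _))//.
  exact: le_trans (fh x) (ler_norm _).
- exact/measurable_EFinP.
- move=> x _; rewrite /= lee_fin (le_trans (ler_Im_normc _))//.
  exact: le_trans (fh x) (ler_norm _).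
Qed.

Let integrableM_cst (k : R) (h : T -> R) :
  mu.-integrable setT (fun x => (h x)%:E) ->
  mu.-integrable setT (fun x => (k * h x)%:E).
Proof. exact: integrableZl. Qed.

Lemma cintegralZ c f : cintegrable f ->
  cintegral (fun x => c * f x) = c * cintegral f.
Proof.
move=> [rf imf]; apply: complex_ext; rewrite ?ReM ?ImM /=.
- under eq_Rintegral do rewrite ReM.
  by rewrite RintegralB ?RintegralZl//; exact: integrableM_cst.
- under eq_Rintegral do rewrite ImM.
  by rewrite RintegralD ?RintegralZl//; exact: integrableM_cst.
Qed.

Lemma cintegrableZ c f : cintegrable f -> cintegrable (fun x => c * f x).
Proof.
move=> [rf imf]; split.
- under eq_fun do rewrite ReM EFinB.
  by apply: integrableB => //; exact: integrableM_cst.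
- under eq_fun do rewrite ImM EFinD.
  by apply: integrableD => //; exact: integrableM_cst.
Qed.

Lemma cintegralD f g : cintegrable f -> cintegrable g ->
  cintegral (fun x => f x + g x) = cintegral f + cintegral g.
Proof.
move=> [rf imf] [rg img]; apply: complex_ext; rewrite ?ReD ?ImD /=.
- by under eq_Rintegral do rewrite ReD; rewrite RintegralD.
- by under eq_Rintegral do rewrite ImD; rewrite RintegralD.
Qed.

Lemma cintegrableD f g : cintegrable f -> cintegrable g ->
  cintegrable (fun x => f x + g x).
Proof.
move=> [rf imf] [rg img]; split.
- by under eq_fun do rewrite ReD EFinD; exact: integrableD.
- by under eq_fun do rewrite ImD EFinD; exact: integrableD.
Qed.

Lemma eq_cintegral f g : f =1 g -> cintegral f = cintegral g.
Proof. by move=> /funext ->. Qed.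

Lemma cintegral_real (h : T -> R) :
  cintegral (fun x => real_complex R (h x)) = real_complex R (\int[mu]_x h x).
Proof.
by apply: complex_ext => //=; rewrite /Rintegral integral0.
Qed.

(** After a rotation that makes the integral real and nonnegative, only the
    integral of a real part is to be bounded. *)
Lemma normc_cintegral_le f : cintegrable f ->
  ((normc (cintegral f))%:E <= \int[mu]_x (normc (f x))%:E)%E.
Proof.
move=> intf.
have mn := measurable_normc (cintegrable_cmeasurable intf).
have [c nc cz] := normc_rotation (cintegral f).
have intcf := cintegrableZ c intf.
rewrite -cz -(cintegralZ c intf) /=.
have fin := integrable_fin_num measurableT intcf.1.
rewrite /Rintegral fineK//; apply: (le_trans (lee_abs _)).
apply: (le_trans (le_abse_integral mu measurableT (measurable_int mu intcf.1))).
apply: ge0_le_integral => //.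
- by apply: measurableT_comp => //; exact: measurable_int intcf.1.
- exact/measurable_EFinP.
- move=> x _; rewrite lee_fin (le_trans (ler_Re_normc _))//.
  by rewrite ComplexField.Normc.normcM nc mul1r.
Qed.

End complex_integral.

(** * Integrals of products of functions of separate variables *)

Section complex_fubini.
Context d1 d2 (T1 : measurableType d1) (T2 : measurableType d2) (R : realType).
Variable m1 : {sigma_finite_measure set T1 -> \bar R}.
Variable m2 : {sigma_finite_measure set T2 -> \bar R}.

Lemma integrable_tensor (f1 : T1 -> R) (f2 : T2 -> R) :
  m1.-integrable setT (fun x => (f1 x)%:E) ->
  m2.-integrable setT (fun x => (f2 x)%:E) ->
  (m1 \x m2)%E.-integrable setT (fun z => (f1 z.1 * f2 z.2)%:E).
Proof.
move=> if1 if2.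
have mf1 := measurable_int m1 if1; have mf2 := measurable_int m2 if2.
apply/integrable12ltyP.
  apply/measurable_EFinP; apply: measurable_funM.
  - by apply: (measurableT_comp (f := f1)); [exact/measurable_EFinP|].
  - by apply: (measurableT_comp (f := f2)); [exact/measurable_EFinP|].
have if2' := integrable_abse if2.
under eq_integral => x _.
  under eq_integral => y _ do rewrite /= normrM EFinM.
  rewrite ge0_integralZl//; last by exact: measurable_int if2'.
  over.
rewrite -[X in (X < _)%E]/(\int[m1]_x (_ * _))%E.
rewrite ge0_integralZr//; last 2 first.
- exact: measurable_int (integrable_abse if1).
- exact: integral_ge0.
have /integrableP[_ if1oo] := if1; have /integrableP[_ if2oo] := if2.
by apply: lte_mul_pinfty => //; rewrite ?ge0_fin_numE// integral_ge0.
Qed.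

Lemma Rintegral_tensor (f1 : T1 -> R) (f2 : T2 -> R) :
  m1.-integrable setT (fun x => (f1 x)%:E) ->
  m2.-integrable setT (fun x => (f2 x)%:E) ->
  \int[(m1 \x m2)%E]_z (f1 z.1 * f2 z.2) =
  (\int[m1]_x f1 x) * (\int[m2]_x f2 x).
Proof.
move=> if1 if2.
rewrite {1}/Rintegral -integral12_prod_meas1; last exact: integrable_tensor.
have fin2 := integrable_fin_num measurableT if2.
transitivity (fine (\int[m1]_x ((f1 x)%:E * \int[m2]_y (f2 y)%:E))%E).
  congr fine; apply: eq_integral => x _; rewrite -integralZl//.
rewrite -(fineK fin2) integralZr// fineM//.
exact: integrable_fin_num.
Qed.

Lemma cintegrable_tensor (f1 : T1 -> R[i]) (f2 : T2 -> R[i]) :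
  cintegrable m1 f1 -> cintegrable m2 f2 ->
  cintegrable (m1 \x m2)%E (fun z => f1 z.1 * f2 z.2).
Proof.
move=> [r1 i1] [r2 i2]; split.
- under eq_fun do rewrite ReM EFinB.
  exact: (integrableB measurableT (integrable_tensor r1 r2)
    (integrable_tensor i1 i2)).
- under eq_fun do rewrite ImM EFinD.
  exact: (integrableD measurableT (integrable_tensor r1 i2)
    (integrable_tensor i1 r2)).
Qed.

Lemma cintegral_tensor (f1 : T1 -> R[i]) (f2 : T2 -> R[i]) :
  cintegrable m1 f1 -> cintegrable m2 f2 ->
  cintegral (m1 \x m2)%E (fun z => f1 z.1 * f2 z.2) =
  cintegral m1 f1 * cintegral m2 f2.
Proof.
move=> [r1 i1] [r2 i2]; apply: complex_ext; rewrite ?ReM ?ImM /=.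
- rewrite (funext (fun z : T1 * T2 => ReM (f1 z.1) (f2 z.2))).
  rewrite (RintegralB measurableT (integrable_tensor r1 r2)
    (integrable_tensor i1 i2)).
  by rewrite (Rintegral_tensor r1 r2) (Rintegral_tensor i1 i2).
- rewrite (funext (fun z : T1 * T2 => ImM (f1 z.1) (f2 z.2))).
  rewrite (RintegralD measurableT (integrable_tensor r1 i2)
    (integrable_tensor i1 r2)).
  by rewrite (Rintegral_tensor r1 i2) (Rintegral_tensor i1 r2).
Qed.

End complex_fubini.

Section integral_rV_products.
Context (R : realType).
Local Notation leb := (@lebesgue_measure R).

(** Fubini by recursion on the dimension, following the recursive construction
    of the Lebesgue measure.  Integrability and value go together because the
    induction step needs both. *)
Lemma cintegrable_rV_prod n (g : 'I_n -> R -> R[i]) :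
  (forall i, cintegrable leb (g i)) ->
  cintegrable (lebesgue_rV R n) (fun x => \prod_(i < n) g i (x ord0 i)) /\
  cintegral (lebesgue_rV R n) (fun x => \prod_(i < n) g i (x ord0 i)) =
  \prod_(i < n) cintegral leb (g i).
Proof.
elim: n g => [|n IH] g ig /=.
  under [in X in cintegrable _ X]eq_fun do rewrite big_ord0.
  under [in X in cintegral _ X]eq_fun do rewrite big_ord0.
  rewrite big_ord0; split.
    by split; apply: finite_measure_integrable_cst.
  apply: complex_ext; rewrite /= /Rintegral.
    rewrite integral_cst// [X in (_ * X)%E](_ : _ = 1%E) ?mule1//.
    exact: diracT.
  by rewrite integral0.
have [IH1 IH2] := IH _ (fun i => ig (lift ord0 i)).
pose F (x : 'rV[R]_n.+1) := \prod_(i < n.+1) g i (x ord0 i).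
pose G (x : 'rV[R]_n) := \prod_(i < n) g (lift ord0 i) (x ord0 i).
have FE z : F (rV_cons z) = g ord0 z.1 * G z.2.
  rewrite /F big_ord_recl rV_cons0; congr (_ * _).
  by apply: eq_bigr => i _; rewrite rV_consS.
have mF : cmeasurable F.
  have mgi i : cmeasurable (fun x : 'rV[R]_n.+1 => g i (x ord0 i)).
    have [mr mi] := cintegrable_cmeasurable (ig i).
    have mc := measurable_rV_coord (R := R) i.
    by split; [exact: measurableT_comp mr mc|exact: measurableT_comp mi mc].
  rewrite /F; elim: (index_enum _) => [|i s IHs].
    under eq_fun do rewrite big_nil; exact: cmeasurable_cst.
  by under eq_fun do rewrite big_cons; exact: cmeasurableM.
have iFG := cintegrable_tensor (ig ord0) IH1.
have mcons := @measurable_rV_cons R n.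
have mrF : measurable_fun setT (fun x => (Re (F x))%:E).
  by apply/measurable_EFinP; exact: mF.1.
have miF : measurable_fun setT (fun x => (Im (F x))%:E).
  by apply/measurable_EFinP; exact: mF.2.
have [irF iiF] : cintegrable (@lebesgue_measure R \x lebesgue_rV R n)%E
    (fun z => F (rV_cons z)) by rewrite (funext FE).
split.
  by split; apply: integrable_pushforward; rewrite ?preimage_setT.
rewrite big_ord_recl -IH2 -(cintegral_tensor (ig ord0) IH1) -(funext FE).
by apply: complex_ext; rewrite /= /Rintegral integral_pushforward//
  preimage_setT.
Qed.

End integral_rV_products.

(** * The complex exponential and derivatives of complex functions *)

Section complex_exponential.
Variable R : realType.
Implicit Types (z w : R[i]) (F G : R -> R[i]).

Definition cexp z : R[i] :=
  Complex (expR (Re z) * cos (Im z)) (expR (Re z) * sin (Im z)).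

Lemma cexp0 : cexp 0 = 1.
Proof. by rewrite /cexp /= expR0 cos0 sin0 mulr1 mulr0. Qed.

Lemma cexpD z w : cexp (z + w) = cexp z * cexp w.
Proof.
apply: complex_ext; rewrite ?ReM ?ImM /cexp /= ReD ImD expRD.
- by rewrite cosD; ring.
- by rewrite sinD; ring.
Qed.

Lemma cexp_sum (I : Type) (s : seq I) (F : I -> R[i]) :
  cexp (\sum_(i <- s) F i) = \prod_(i <- s) cexp (F i).
Proof.
elim: s => [|i s IH]; first by rewrite !big_nil cexp0.
by rewrite !big_cons cexpD IH.
Qed.

Lemma normc_cexp z : normc (cexp z) = expR (Re z).
Proof.
apply/eqP; rewrite -(@eqrXn2 _ 2) ?normc_ge0 ?expR_ge0// sqr_normc /=.
by rewrite !exprMn -mulrDr cos2Dsin2 mulr1.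
Qed.

Lemma expiE (theta : R) : expi theta = cexp (Complex 0 theta).
Proof. by rewrite /cexp /= expR0 !mul1r. Qed.

Lemma cexp_real (a : R) : cexp (real_complex R a) = real_complex R (expR a).
Proof. by rewrite /cexp /= cos0 sin0 mulr1 mulr0. Qed.

(** Taken part by part, so that the rules of real calculus apply directly. *)
Definition is_cderive F (x : R) (L : R[i]) :=
  is_derive x (1 : R) (fun y => Re (F y)) (Re L) /\
  is_derive x (1 : R) (fun y => Im (F y)) (Im L).

Lemma is_cderive_cst (c : R[i]) x : is_cderive (fun=> c) x 0.
Proof. by split; exact: is_derive_cst. Qed.

Lemma is_cderive_real (h : R -> R) (x l : R) : is_derive x 1 h l ->
  is_cderive (fun y => real_complex R (h y)) x (real_complex R l).
Proof. by move=> hl; split => //; exact: is_derive_cst. Qed.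

Lemma is_cderiveD F G x K L : is_cderive F x K -> is_cderive G x L ->
  is_cderive (fun y => F y + G y) x (K + L).
Proof.
move=> [rF iF] [rG iG]; split.
- rewrite (funext (fun y => ReD (F y) (G y))) ReD; exact: is_deriveD.
- rewrite (funext (fun y => ImD (F y) (G y))) ImD; exact: is_deriveD.
Qed.

Lemma is_cderiveM F G x K L : is_cderive F x K -> is_cderive G x L ->
  is_cderive (fun y => F y * G y) x (K * G x + F x * L).
Proof.
move=> [rF iF] [rG iG]; split.
- rewrite (funext (fun y => ReM (F y) (G y))).
  apply: is_derive_eq (is_deriveB (is_deriveM rF rG) (is_deriveM iF iG)) _.
  by rewrite ReD !ReM /GRing.scale/=; ring.
- rewrite (funext (fun y => ImM (F y) (G y))).
  apply: is_derive_eq (is_deriveD (is_deriveM rF iG) (is_deriveM iF rG)) _.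
  by rewrite ImD !ImM /GRing.scale/=; ring.
Qed.

Lemma is_cderiveZ (c : R[i]) F x L :
  is_cderive F x L -> is_cderive (fun y => c * F y) x (c * L).
Proof.
move=> FL; have := is_cderiveM (is_cderive_cst c x) FL.
by rewrite mul0r add0r.
Qed.

Lemma is_cderive_cexp F x L : is_cderive F x L ->
  is_cderive (fun y => cexp (F y)) x (L * cexp (F x)).
Proof.
move=> [rF iF].
have de := is_derive1_comp (is_derive_expR (Re (F x))) rF.
have dc := is_derive1_comp (is_derive_cos (Im (F x))) iF.
have ds := is_derive1_comp (is_derive_sin (Im (F x))) iF.
split.
- apply: is_derive_eq (is_deriveM de dc) _.
  by rewrite ReM /GRing.scale/=; ring.
- apply: is_derive_eq (is_deriveM de ds) _.
  by rewrite ImM /GRing.scale/=; ring.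
Qed.

Lemma is_cderive_0_is_cst F x y : (forall t : R, is_cderive F t 0) -> F x = F y.
Proof.
move=> dF; apply: complex_ext.
- by apply: (is_derive_0_is_cst (f := fun x => Re (F x))) => z; have [] := dF z.
- by apply: (is_derive_0_is_cst (f := fun x => Im (F x))) => z; have [] := dF z.
Qed.

End complex_exponential.

(** * Integration by parts and differentiation under the integral *)

Section calculus_of_integrals.
Variable R : realType.
Local Notation leb := (@lebesgue_measure R).

Lemma is_derive_continuous (F f : R -> R) :
  (forall x, is_derive x (1 : R) F (f x)) -> continuous F.
Proof.
move=> dF x; have [dFx _] := dF x.
exact/differentiable_continuous/derivable1_diffP.
Qed.

(** The fundamental theorem of calculus on $[-k-1, k+1]$, whose boundary terms
    are $O(1/k)$, and dominated convergence as $k \to \infty$. *)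
Lemma Rintegral_derive_eq0 (F f : R -> R) (C : R) :
  (forall x, is_derive x (1 : R) F (f x)) -> continuous f ->
  leb.-integrable setT (fun x => (f x)%:E) ->
  (forall x, `|x| * `|F x| <= C) -> \int[leb]_x f x = 0.
Proof.
move=> dF cf intf FC.
pose A k : set R := [set` `[- k.+1%:R, k.+1%:R]].
pose fk k := (EFin \o f) \_ (A k).
have mf : measurable_fun setT f by exact: continuous_measurable_fun.
have intA k : (\int[leb]_x fk k x = (F k.+1%:R - F (- k.+1%:R))%:E)%E.
  rewrite /fk -integral_mkcond.
  rewrite (@continuous_FTC2 _ f F)//.
  - by rewrite gtrN.
  - by apply: continuous_subspaceT.
  - have cF := is_derive_continuous dF; split.
    + by move=> x _; have [] := dF x.
    + by apply: cvg_at_right_filter; exact: cF.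
    + by apply: cvg_at_left_filter; exact: cF.
  - by move=> x _; rewrite derive1E; have [_ ->] := dF x.
have := @dominated_convergence _ _ _ leb setT measurableT fk
  (fun x => (f x)%:E) (fun x => `|f x|%:E).
case=> //; last move=> _ _ cvI.
- move=> k; apply: (measurable_restrictT _ _).1 => //.
    exact: measurable_itv.
  by apply/measurable_EFinP; exact: measurable_funTS.
- exact/measurable_EFinP.
- apply: aeW => x _; apply: cvg_near_cst.
  near=> k; rewrite /fk patchE ifT// inE /A/= in_itv/= -ler_norml.
  rewrite (@le_trans _ _ k%:R)// ?ler_nat//.
  by near: k; exact: nbhs_infty_ger.
- exact: integrable_abse intf.
- apply: aeW => x k _; rewrite /fk patchE /=; case: ifPn => // _.
  by rewrite abse0 lee_fin.
rewrite (funext intA) in cvI.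
have cv0 : (F k.+1%:R - F (- k.+1%:R))%:E @[k --> \oo] --> 0%E.
  apply: cvg_EFin; first exact: nearW.
  apply: norm_cvg0.
  apply: (@squeeze_cvgr _ _ _ _ (cst 0) (fun k => (2 * C) *: @harmonic R k)).
  - apply: nearW => k; rewrite normr_ge0 /= /harmonic /GRing.scale/=.
    have b x : `|x| = k.+1%:R -> `|F x| <= C / k.+1%:R.
      by move=> xk; rewrite ler_pdivlMr ?ltr0n// mulrC -xk.
    apply: le_trans (ler_normB _ _) _.
    rewrite -mulrA mulr_natl mulr2n lerD// b// ?normrN ger0_norm//.
  - exact: cvg_cst.
  - rewrite -[X in _ --> X](scaler0 _ (2 * C)).
    by apply: cvgZr; exact: cvg_harmonic.
by rewrite /Rintegral -(cvg_lim _ cvI)// (cvg_lim _ cv0).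
Unshelve. all: by end_near. Qed.

(** A second derivative [g] is asked for only to make [f] continuous. *)
Lemma cintegral_derive_eq0 (F f g : R -> R[i]) (C : R) :
  (forall x, is_cderive F x (f x)) -> (forall x, is_cderive f x (g x)) ->
  cintegrable leb f -> (forall x, `|x| * normc (F x) <= C) ->
  cintegral leb f = 0.
Proof.
move=> dF df [ir ii] FC; apply: complex_ext => /=.
- apply: (@Rintegral_derive_eq0 (fun x => Re (F x)) _ C) => //.
  + by move=> x; have [] := dF x.
  + apply: (is_derive_continuous (f := fun x => Re (g x))) => x.
    by have [] := df x.
  + by move=> x; apply: le_trans (FC x); rewrite ler_wpM2l// ler_Re_normc.
- apply: (@Rintegral_derive_eq0 (fun x => Im (F x)) _ C) => //.
  + by move=> x; have [] := dF x.
  + apply: (is_derive_continuous (f := fun x => Im (g x))) => x.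
    by have [] := df x.
  + by move=> x; apply: le_trans (FC x); rewrite ler_wpM2l// ler_Im_normc.
Qed.

End calculus_of_integrals.

Section derivative_under_integral.
Context d (T : measurableType d) (R : realType).
Variable mu : {measure set T -> \bar R}.

Lemma is_derive_under_integral (f f' : R -> T -> R) (h : T -> R) (a : R) :
  (forall x, mu.-integrable setT (fun y => (f x y)%:E)) ->
  (forall x y, is_derive x (1 : R) (f^~ y) (f' x y)) ->
  mu.-integrable setT (fun y => (h y)%:E) ->
  (forall x y, `|f' x y| <= h y) ->
  is_derive a (1 : R) (fun x => \int[mu]_y f x y) (\int[mu]_y f' a y).
Proof.
move=> intf df inth f'h.
have h0 y : 0 <= h y by exact: le_trans (f'h 0 y).
(* the domination is global, so any neighbourhood of a will do *)
have aI : [set` `]a - 1, a + 1[] a by rewrite /= in_itv/= ltrBlDr ltrDl ltr01.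
have dE x y : partial1of2 f x y = f' x y.
  by rewrite partial1of2E; have [_ ->] := df x y.
have der : forall x y, [set` `]a - 1, a + 1[] x -> setT y ->
    derivable (f ^~ y) x 1.
  by move=> x y _ _; have [] := df x y.
have bnd : forall x y, [set` `]a - 1, a + 1[] x -> setT y ->
    `|partial1of2 f x y| <= h y.
  by move=> x y _ _; rewrite dE.
have intf' : forall x, [set` `]a - 1, a + 1[] x ->
    mu.-integrable setT (EFin \o f x).
  by move=> x _; exact: intf.
split.
  exact: (derivable_under_integral measurableT aI intf' der h0 inth bnd).
rewrite -derive1E.
rewrite (differentiation_under_integral measurableT aI intf' der h0 inth bnd).
by apply: eq_Rintegral => y _; rewrite dE.
Qed.

Lemma is_cderive_under_integral (f f' : R -> T -> R[i]) (h : T -> R) (a : R) :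
  (forall x, cintegrable mu (f x)) ->
  (forall x y, is_cderive (f^~ y) x (f' x y)) ->
  mu.-integrable setT (fun y => (h y)%:E) ->
  (forall x y, normc (f' x y) <= h y) ->
  is_cderive (fun x => cintegral mu (f x)) a (cintegral mu (f' a)).
Proof.
move=> intf df inth f'h; split => /=.
- apply: (@is_derive_under_integral (fun x y => Re (f x y))
    (fun x y => Re (f' x y)) h) => //.
  + by move=> x; have [] := intf x.
  + by move=> x y; have [] := df x y.
  + by move=> x y; exact: le_trans (ler_Re_normc _) (f'h x y).
- apply: (@is_derive_under_integral (fun x y => Im (f x y))
    (fun x y => Im (f' x y)) h) => //.
  + by move=> x; have [] := intf x.
  + by move=> x y; have [] := df x y.
  + by move=> x y; exact: le_trans (ler_Im_normc _) (f'h x y).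
Qed.

End derivative_under_integral.

(** * One-dimensional Gaussians of complex width *)

Section gaussian_weights.
Variable R : realType.
Local Notation leb := (@lebesgue_measure R).
Implicit Types a : R.

Lemma is_derive_sqr (x : R) : is_derive x (1 : R) (fun t : R => t ^+ 2) (2 * x).
Proof.
apply: is_derive_eq (is_deriveX 2 (is_derive_id x 1)) _.
by rewrite /GRing.scale/= expr1 mulr1.
Qed.

Lemma continuous_gauss a : continuous (fun x : R => expR (- a * x ^+ 2)).
Proof.
pose f (x : R) := - a * (2 * x) * expR (- a * x ^+ 2).
apply: (is_derive_continuous (f := f)) => x.
have dX : is_derive x (1 : R) (fun x : R => - a * x ^+ 2) (- a * (2 * x)).
  apply: is_derive_eq (is_deriveM (is_derive_cst (- a) x 1)
    (is_derive_sqr x)) _.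
  by rewrite /GRing.scale/= mulr0 addr0.
apply: is_derive_eq (is_derive1_comp (is_derive_expR _) dX) _.
by rewrite mulrC.
Qed.

Lemma integral_gauss a : 0 < a ->
  (\int[leb]_x (expR (- a * x ^+ 2))%:E)%E = (Num.sqrt (pi / a))%:E.
Proof.
(* the normal density of variance 1/(2a) is this Gaussian up to a constant *)
move=> a0; pose s := Num.sqrt ((2 * a)^-1).
have s0 : s != 0 by rewrite gt_eqF// sqrtr_gt0 invr_gt0 mulr_gt0.
have s2 : s ^+ 2 = (2 * a)^-1.
  by rewrite sqr_sqrtr// invr_ge0 mulr_ge0// ltW.
have aN0 : a != 0 by rewrite gt_eqF.
have peakE : (normal_peak s)^-1 = Num.sqrt (pi / a).
  by rewrite /normal_peak invrK s2; congr Num.sqrt; field.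
have peak0 : normal_peak s != 0 by rewrite gt_eqF// normal_peak_gt0.
have pdfE x : expR (- a * x ^+ 2) = (normal_peak s)^-1 * normal_pdf 0 s x.
  rewrite normal_pdfE// mulKf// /normal_fun s2 subr0; congr expR.
  by field.
under eq_integral do rewrite pdfE EFinM.
rewrite integralZl//; last exact: integrable_normal_pdf.
by rewrite integral_normal_pdf mule1 peakE.
Qed.

Lemma integrable_gauss a : 0 < a ->
  leb.-integrable setT (fun x => (expR (- a * x ^+ 2))%:E).
Proof.
move=> a0; apply/integrableP; split.
  apply/measurable_EFinP; apply: continuous_measurable_fun.
  exact: continuous_gauss.
under eq_integral do rewrite /= ger0_norm ?expR_ge0//.
by rewrite integral_gauss// ltry.
Qed.

(** Half of the decay absorbs the quadratic factor, since $u \le e^u$. *)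
Lemma gauss_moment_le a x : 0 < a ->
  (1 + x ^+ 2) * expR (- a * x ^+ 2) <=
  (1 + 2 / a) * expR (- (a / 2) * x ^+ 2).
Proof.
move=> a0; set u := a / 2 * x ^+ 2.
have u0 : 0 <= u by rewrite mulr_ge0 ?sqr_ge0// divr_ge0// ltW.
have -> : - a * x ^+ 2 = - u + - u by rewrite /u; field.
have -> : - (a / 2) * x ^+ 2 = - u by rewrite /u; ring.
rewrite expRD mulrA ler_wpM2r ?expR_ge0// expRN ler_pdivrMr ?expR_gt0//.
have -> : x ^+ 2 = 2 / a * u by rewrite /u; field; rewrite gt_eqF.
have := expR_ge1Dx u.
have e1 : 1 <= expR u by rewrite -expR0 ler_expR.
have : 0 <= 2 / a by rewrite divr_ge0// ltW.
move: (2 / a) (expR u) e1 => c e; nra.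
Qed.

Lemma gauss_moment_bounded a x : 0 < a ->
  (1 + x ^+ 2) * expR (- a * x ^+ 2) <= 1 + 2 / a.
Proof.
move=> a0; apply: (le_trans (gauss_moment_le x a0)).
apply: ler_piMr; first by rewrite addr_ge0// divr_ge0// ltW.
by rewrite expR_le1 mulNr oppr_le0 mulr_ge0 ?sqr_ge0// divr_ge0// ltW.
Qed.

End gaussian_weights.

Section complex_gaussian.
Variable R : realType.
Local Notation leb := (@lebesgue_measure R).
Local Notation "x %:C" := (real_complex R x).
Local Notation i := (Complex 0 1 : R[i]).
Implicit Types (w : R[i]) (x y : R).

(** The integrand $e^{-wy^2 - ixy}$ of the Fourier transform of a Gaussian, kept
    as one exponential so that Gaussians and plane waves multiply by adding
    their parameters. *)
Definition cgauss w x y : R[i] := cexp (- (w * (y ^+ 2)%:C) - i * (x * y)%:C).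

Lemma mulii : i * i = -1.
Proof. by apply: complex_ext; rewrite ?ReM ?ImM /=; ring. Qed.

Lemma Re_gt0_neq0 w : 0 < Re w -> w != 0.
Proof. by move=> w0; apply/eqP => w00; rewrite w00 ltxx in w0. Qed.

Lemma normc_cgauss w x y : normc (cgauss w x y) = expR (- Re w * y ^+ 2).
Proof.
rewrite normc_cexp; congr expR.
by rewrite ReD !ReN !ReM /=; ring.
Qed.

Lemma is_cderive_id y : is_cderive (fun y => y%:C) y 1.
Proof. by have := is_cderive_real (is_derive_id y 1). Qed.

Lemma is_cderive_cgauss_y w x y : is_cderive (cgauss w x) y
  ((- (2 * w) * y%:C - i * x%:C) * cgauss w x y).
Proof.
apply: is_cderive_cexp.
rewrite (_ : (fun t => _) =
    (fun t => - w * (t ^+ 2)%:C + - (i * x%:C) * t%:C)); last first.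
  by apply/funext => t; rewrite rmorphM /=; ring.
have := is_cderiveD (is_cderiveZ (- w) (is_cderive_real (is_derive_sqr y)))
  (is_cderiveZ (- (i * x%:C)) (is_cderive_id y)).
by congr is_cderive; rewrite rmorphM; ring.
Qed.

Lemma is_cderive_cgauss_x w x y :
  is_cderive (fun x => cgauss w x y) x (- i * y%:C * cgauss w x y).
Proof.
apply: is_cderive_cexp.
rewrite (_ : (fun t => _) =
    (fun t => - (w * (y ^+ 2)%:C) + - (i * y%:C) * t%:C)); last first.
  by apply/funext => t; rewrite rmorphM /=; ring.
have := is_cderiveD (is_cderive_cst (- (w * (y ^+ 2)%:C)) x)
  (is_cderiveZ (- (i * y%:C)) (is_cderive_id x)).
by congr is_cderive; ring.
Qed.

Lemma is_cderive_Complex a (b : R) : is_cderive (fun t => Complex a t) b i.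
Proof. by split => /=; [exact: is_derive_cst|exact: is_derive_id]. Qed.

Lemma is_cderive_cgauss_Im a b y :
  is_cderive (fun t => cgauss (Complex a t) 0 y) b
    (- i * (y ^+ 2)%:C * cgauss (Complex a b) 0 y).
Proof.
apply: is_cderive_cexp.
rewrite (_ : (fun t => _) = (fun t => - (y ^+ 2)%:C * Complex a t)); last first.
  by apply/funext => t; rewrite mul0r rmorph0; ring.
have := is_cderiveZ (- (y ^+ 2)%:C) (is_cderive_Complex a b).
by congr is_cderive; ring.
Qed.

Lemma is_cderive_cmeasurable (F f : R -> R[i]) :
  (forall x, is_cderive F x (f x)) -> cmeasurable F.
Proof.
move=> dF; split; apply: continuous_measurable_fun;
  by apply: is_derive_continuous => x; have [] := dF x.
Qed.

Lemma cmeasurable_id : cmeasurable (fun y : R => y%:C).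
Proof. exact: cmeasurable_real. Qed.

Lemma cmeasurable_sqr : cmeasurable (fun y : R => (y ^+ 2)%:C).
Proof. by apply: cmeasurable_real; exact: measurable_funX. Qed.

Lemma cintegrable_cgauss_mul (P : R -> R[i]) (C : R) w x : 0 < Re w ->
  cmeasurable P -> (forall y, normc (P y) <= C * (1 + y ^+ 2)) ->
  cintegrable leb (fun y => P y * cgauss w x y).
Proof.
move=> w0 mP PC.
have C0 : 0 <= C.
  have := le_trans (normc_ge0 _) (PC 0).
  by rewrite expr0n addr0 mulr1.
have w20 : 0 < Re w / 2 by rewrite divr_gt0.
apply: (@cintegrable_dominated _ _ _ leb _
  (fun y => C * (1 + 2 / Re w) * expR (- (Re w / 2) * y ^+ 2))).
- apply: cmeasurableM => //.
  exact: is_cderive_cmeasurable (is_cderive_cgauss_y w x).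
- under eq_fun do rewrite EFinM.
  by apply: integrableZl => //; exact: integrable_gauss.
- move=> y; rewrite ComplexField.Normc.normcM normc_cgauss -mulrA.
  apply: (@le_trans _ _ (C * (1 + y ^+ 2) * expR (- Re w * y ^+ 2))).
    by rewrite ler_wpM2r// expR_ge0.
  by rewrite -mulrA ler_wpM2l// gauss_moment_le.
Qed.

Lemma cintegrable_cgauss w x : 0 < Re w -> cintegrable leb (cgauss w x).
Proof.
move=> w0.
have := @cintegrable_cgauss_mul (fun=> 1) 1 w x w0 (cmeasurable_cst _ _).
under eq_fun do rewrite mul1r.
by apply=> y; rewrite ComplexField.Normc.normc1 mul1r lerDl sqr_ge0.
Qed.

Let ler_norm_1Dsqr y : `|y| <= 1 * (1 + y ^+ 2).
Proof.
rewrite mul1r -real_normK ?num_real//.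
by move: `|y| (normr_ge0 y) => z; nra.
Qed.

Lemma cintegrable_y_cgauss w x : 0 < Re w ->
  cintegrable leb (fun y => y%:C * cgauss w x y).
Proof.
move=> w0; apply: (@cintegrable_cgauss_mul _ 1) => //.
  exact: cmeasurable_id.
by move=> y; rewrite normc_real.
Qed.

Lemma cintegrable_sqr_cgauss w x : 0 < Re w ->
  cintegrable leb (fun y => (y ^+ 2)%:C * cgauss w x y).
Proof.
move=> w0; apply: (@cintegrable_cgauss_mul _ 1) => //.
  exact: cmeasurable_sqr.
by move=> y; rewrite normc_real ger0_norm ?sqr_ge0// mul1r lerDr.
Qed.

Definition gauss_int w x : R[i] := cintegral leb (cgauss w x).

(** The integral over the line of $\partial_y e^{-wy^2 - ixy}$ vanishes. *)
Lemma first_moment_cgauss w x : 0 < Re w ->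
  2 * w * cintegral leb (fun y => y%:C * cgauss w x y) =
  - (i * x%:C) * gauss_int w x.
Proof.
move=> w0.
have i0 := cintegrable_cgauss x w0; have i1 := cintegrable_y_cgauss x w0.
pose q := 2 * w.
have fE y : (- q * y%:C - i * x%:C) * cgauss w x y =
    - q * (y%:C * cgauss w x y) + - (i * x%:C) * cgauss w x y.
  by ring.
have : cintegral leb (fun y => (- q * y%:C - i * x%:C) * cgauss w x y) = 0.
  apply: (@cintegral_derive_eq0 R (cgauss w x) _ _ (1 + 2 / Re w)
    (is_cderive_cgauss_y w x)).
  - move=> y; apply: is_cderiveM; last exact: is_cderive_cgauss_y.
    apply: is_cderiveD; last exact: is_cderive_cst.
    exact: is_cderiveZ (is_cderive_id y).
  - rewrite (funext fE); apply: cintegrableD; exact: cintegrableZ.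
  - move=> y; apply: le_trans (gauss_moment_bounded y w0).
    rewrite normc_cgauss ler_wpM2r ?expR_ge0//.
    by have := ler_norm_1Dsqr y; rewrite mul1r.
rewrite (funext fE) cintegralD; try exact: cintegrableZ.
by rewrite !cintegralZ// mulNr addrC => /eqP; rewrite subr_eq0 => /eqP.
Qed.

(** The integral over the line of $\partial_y (y e^{-wy^2})$ vanishes. *)
Lemma second_moment_cgauss w : 0 < Re w ->
  2 * w * cintegral leb (fun y => (y ^+ 2)%:C * cgauss w 0 y) =
  gauss_int w 0.
Proof.
move=> w0.
have i0 := cintegrable_cgauss 0 w0; have i2 := cintegrable_sqr_cgauss 0 w0.
pose q := 2 * w.
have fE y : 1 * cgauss w 0 y + y%:C * ((- q * y%:C - i * 0%:C) * cgauss w 0 y) =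
    cgauss w 0 y + - q * ((y ^+ 2)%:C * cgauss w 0 y).
  by rewrite [in RHS]rmorphXn rmorph0; ring.
have : cintegral leb (fun y =>
    1 * cgauss w 0 y + y%:C * ((- q * y%:C - i * 0%:C) * cgauss w 0 y)) = 0.
  apply: (@cintegral_derive_eq0 R (fun y => y%:C * cgauss w 0 y) _ _
    (1 + 2 / Re w)).
  - move=> y; apply: is_cderiveM (is_cderive_id y) _.
    exact: is_cderive_cgauss_y.
  - move=> y; apply: is_cderiveD.
      by apply: is_cderiveZ; exact: is_cderive_cgauss_y.
    apply: is_cderiveM (is_cderive_id y) _.
    apply: is_cderiveM; last exact: is_cderive_cgauss_y.
    apply: is_cderiveD; last exact: is_cderive_cst.
    exact: is_cderiveZ (is_cderive_id y).
  - by rewrite (funext fE); apply: cintegrableD => //; exact: cintegrableZ.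
  - move=> y; apply: le_trans (gauss_moment_bounded y w0).
    rewrite ComplexField.Normc.normcM normc_real normc_cgauss mulrA.
    rewrite -expr2 real_normK ?num_real// ler_wpM2r ?expR_ge0//.
    by rewrite lerDr.
rewrite (funext fE) cintegralD//; try exact: cintegrableZ.
by rewrite cintegralZ// mulNr => /eqP; rewrite subr_eq0 => /eqP.
Qed.

Lemma is_cderive_gauss_int_x w x : 0 < Re w ->
  is_cderive (gauss_int w) x (- (x%:C / (2 * w)) * gauss_int w x).
Proof.
move=> w0.
have wn0 := Re_gt0_neq0 w0.
have := @is_cderive_under_integral _ _ R leb (cgauss w)
  (fun x y => - i * y%:C * cgauss w x y)
  (fun y => (1 + 2 / Re w) * expR (- (Re w / 2) * y ^+ 2)) x.
rewrite /gauss_int (_ : cintegral leb (fun y => - i * y%:C * cgauss w x y) =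
    - (x%:C / (2 * w)) * gauss_int w x); last first.
  have fE y : - i * y%:C * cgauss w x y = - i * (y%:C * cgauss w x y) by ring.
  rewrite (funext fE) cintegralZ; last exact: cintegrable_y_cgauss.
  have q0 : 2 * w != 0 by rewrite mulf_neq0// pnatr_eq0.
  apply: (mulfI q0); rewrite mulrCA first_moment_cgauss//.
  transitivity (i * i * x%:C * gauss_int w x); first by ring.
  by rewrite mulii; field; rewrite wn0.
apply.
- by move=> x'; exact: cintegrable_cgauss.
- by move=> x' y; exact: is_cderive_cgauss_x.
- under eq_fun do rewrite EFinM.
  by apply: integrableZl => //; apply: integrable_gauss; rewrite divr_gt0.
- move=> x' y; rewrite !ComplexField.Normc.normcM normc_cgauss.
  apply: le_trans (gauss_moment_le y w0); rewrite ler_wpM2r ?expR_ge0//.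
  rewrite normc_real /= oppr0 expr0n add0r sqrrN expr1n sqrtr1 mul1r.
  by have := ler_norm_1Dsqr y; rewrite mul1r.
Qed.

(** Both sides solve $F' = -\frac{x}{2w} F$ with the same value at $0$. *)
Lemma gauss_intE w x : 0 < Re w ->
  gauss_int w x = gauss_int w 0 * cexp (- ((x ^+ 2)%:C / (4 * w))).
Proof.
move=> w0.
have wn0 := Re_gt0_neq0 w0.
pose E x := cexp ((x ^+ 2)%:C / (4 * w)).
have dE t : is_cderive E t (t%:C / (2 * w) * E t).
  apply: is_cderive_cexp.
  have := is_cderiveZ (4 * w)^-1 (is_cderive_real (is_derive_sqr t)).
  rewrite (_ : (fun y => _) = (fun y => (y ^+ 2)%:C / (4 * w))); last first.
    by apply/funext => s; rewrite mulrC.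
  by congr is_cderive; field; rewrite wn0.
have : gauss_int w x * E x = gauss_int w 0 * E 0.
  apply: (is_cderive_0_is_cst (F := fun x => gauss_int w x * E x)) => t.
  have := is_cderiveM (is_cderive_gauss_int_x t w0) (dE t).
  by congr is_cderive; ring.
rewrite {2}/E expr0n rmorph0 mul0r cexp0 mulr1 => <-.
by rewrite -mulrA -cexpD subrr cexp0 mulr1.
Qed.

Lemma gauss_int_real (a : R) : 0 < a ->
  gauss_int a%:C 0 = (Num.sqrt (pi / a))%:C.
Proof.
move=> a0; rewrite /gauss_int.
rewrite -(_ : \int[leb]_y expR (- a * y ^+ 2) = Num.sqrt (pi / a)).
  rewrite -cintegral_real; apply: eq_cintegral => y.
  rewrite /cgauss -cexp_real; congr cexp.
  by apply: complex_ext; rewrite /= ; ring.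
by rewrite /Rintegral integral_gauss.
Qed.

(** $I' = -\frac{i}{2w} I$ along the imaginary direction, so that $w I^2$ keeps
    the value $\pi$ that it has on the positive axis.  Squaring avoids a choice
    of the square root of $\pi / w$. *)
Lemma sqr_gauss_int0 w : 0 < Re w -> gauss_int w 0 ^+ 2 * w = pi%:C.
Proof.
case: w => a b /= a0.
pose J t := gauss_int (Complex a t) 0.
have dJ t : is_cderive J t (- i / (2 * Complex a t) * J t).
  have wn0 : Complex a t != 0 by exact: Re_gt0_neq0.
  have := @is_cderive_under_integral _ _ R leb (fun t => cgauss (Complex a t) 0)
    (fun t y => - i * (y ^+ 2)%:C * cgauss (Complex a t) 0 y)
    (fun y => (1 + 2 / a) * expR (- (a / 2) * y ^+ 2)) t.
  rewrite (_ : cintegral leb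
      (fun y => - i * (y ^+ 2)%:C * cgauss (Complex a t) 0 y) =
      - i / (2 * Complex a t) * J t); last first.
    have fE y : - i * (y ^+ 2)%:C * cgauss (Complex a t) 0 y =
      - i * ((y ^+ 2)%:C * cgauss (Complex a t) 0 y) by ring.
    rewrite (funext fE) cintegralZ; last exact: cintegrable_sqr_cgauss.
    rewrite -mulrA; congr (_ * _).
    by rewrite /J -second_moment_cgauss// mulKf// mulf_neq0// pnatr_eq0.
  apply.
  - by move=> x'; exact: cintegrable_cgauss.
  - by move=> x' y; exact: is_cderive_cgauss_Im.
  - under eq_fun do rewrite EFinM.
    by apply: integrableZl => //; apply: integrable_gauss; rewrite divr_gt0.
  - move=> x' y; rewrite !ComplexField.Normc.normcM normc_cgauss.
    apply: le_trans (gauss_moment_le y a0); rewrite ler_wpM2r ?expR_ge0//.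
    rewrite normc_real /= oppr0 expr0n add0r sqrrN expr1n sqrtr1 mul1r.
    by rewrite ger0_norm ?sqr_ge0// lerDr.
have -> : gauss_int (Complex a b) 0 ^+ 2 * Complex a b = J 0 ^+ 2 * Complex a 0.
  rewrite !expr2.
  apply: (is_cderive_0_is_cst (F := fun t => J t * J t * Complex a t)) => t.
  have := is_cderiveM (is_cderiveM (dJ t) (dJ t)) (is_cderive_Complex a t).
  have wn0 : Complex a t != 0 by exact: Re_gt0_neq0.
  by congr is_cderive; field.
rewrite /J complexr0 gauss_int_real//.
rewrite -rmorphXn -rmorphM sqr_sqrtr ?divr_ge0 ?pi_ge0 ?(ltW a0)//.
by rewrite divfK// gt_eqF.
Qed.

Lemma normc_gauss_int0 w : 0 < Re w ->
  normc (gauss_int w 0) ^+ 2 * normc w = pi.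
Proof.
move=> w0; rewrite -normcX -ComplexField.Normc.normcM sqr_gauss_int0//.
by rewrite normc_real ger0_norm// pi_ge0.
Qed.

End complex_gaussian.

(** * Gaussians are Schwartz functions *)

Section gaussian_schwartz.
Variables (R : realType) (n : nat).
Implicit Types (x v : 'rV[R]_n) (P Q : 'rV[R]_n -> R).

(** Polynomial functions, as the closure needed to describe all the iterated
    partial derivatives of a Gaussian: each is a polynomial times it. *)
Inductive polyfun : ('rV[R]_n -> R) -> Prop :=
| polyfun_cst c : polyfun (fun=> c)
| polyfun_coord i : polyfun (fun x => x ord0 i)
| polyfunD P Q : polyfun P -> polyfun Q -> polyfun (P + Q)
| polyfunM P Q : polyfun P -> polyfun Q -> polyfun (P * Q).

Lemma differentiable_polyfun P x : polyfun P -> differentiable P x.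
Proof.
elim=> {P} [c|i|P Q _ dP _ dQ|P Q _ dP _ dQ].
- exact: differentiable_cst.
- exact: differentiable_coord.
- exact: differentiableD.
- exact: differentiableM.
Qed.

Lemma derive_coord v (i : 'I_n) x :
  'D_v (fun x : 'rV[R]_n => x ord0 i) x = v ord0 i.
Proof.
rewrite /derive; apply: cvg_lim => //; apply: cvg_near_cst.
near=> h; rewrite /= !mxE addrK /GRing.scale/= mulKf//.
by near: h; exact: nbhs_dnbhs_neq.
Unshelve. all: by end_near. Qed.

Lemma polyfun_derive P v : polyfun P -> polyfun ('D_v P).
Proof.
elim=> {P} [c|i|P Q pP dP pQ dQ|P Q pP dP pQ dQ].
- rewrite (_ : 'D_v _ = fun=> 0); first exact: polyfun_cst.
  by apply/funext => x; rewrite derive_cst.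
- rewrite (_ : 'D_v _ = fun=> v ord0 i); first exact: polyfun_cst.
  by apply/funext => x; rewrite derive_coord.
- rewrite (_ : 'D_v _ = 'D_v P + 'D_v Q); first exact: polyfunD.
  by apply/funext => x; rewrite deriveD//; apply: diff_derivable;
    exact: differentiable_polyfun.
- rewrite (_ : 'D_v _ = P * 'D_v Q + Q * 'D_v P).
    by apply: polyfunD; exact: polyfunM.
  by apply/funext => x; rewrite deriveM//; apply: diff_derivable;
    exact: differentiable_polyfun.
Qed.

Lemma ler_coord_norm x i : `|x ord0 i| <= `|x|.
Proof.
rewrite [leRHS]mx_normrE.
exact: (le_bigmax _ (fun ij => `|x ij.1 ij.2|) (ord0, i)).
Qed.

Lemma dot_rV_ge0 x : 0 <= dot_rV x x.
Proof. by apply: sumr_ge0 => i _; rewrite -expr2 sqr_ge0. Qed.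

Lemma ler_sqr_norm_dot x : `|x| ^+ 2 <= dot_rV x x.
Proof.
have [->|x0] := eqVneq `|x| 0.
  by rewrite expr0n dot_rV_ge0.
have [[j i] xE] := mx_norm_neq0 x0.
rewrite -[`|x|]/(mx_norm x) xE /= (ord1 j) real_normK ?num_real//.
rewrite /dot_rV (bigD1 i)//= -expr2 lerDl.
by apply: sumr_ge0 => k _; rewrite -expr2 sqr_ge0.
Qed.

Lemma polyfun_growth P : polyfun P ->
  exists C m, forall x, `|P x| <= C * (1 + `|x|) ^+ m.
Proof.
have ge1 x m : 1 <= (1 + `|x|) ^+ m by rewrite exprn_ege1// lerDl.
elim=> {P} [c|i|P Q _ [C [m PC]] _ [D [k QD]]|P Q _ [C [m PC]] _ [D [k QD]]].
- by exists `|c|, 0%N => x; rewrite expr0 mulr1.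
- exists 1, 1%N => x; rewrite mul1r expr1.
  by rewrite (le_trans (ler_coord_norm x i))// lerDr.
- have C0 : 0 <= C.
    by have := le_trans (normr_ge0 _) (PC 0); rewrite normr0 addr0 expr1n mulr1.
  have D0 : 0 <= D.
    by have := le_trans (normr_ge0 _) (QD 0); rewrite normr0 addr0 expr1n mulr1.
  exists (C + D), (m + k)%N => x; rewrite (le_trans (ler_normD _ _))// mulrDl.
  rewrite exprD lerD//.
    apply: le_trans (PC x) _; rewrite mulrA; apply: ler_peMr => //.
    by apply: mulr_ge0 => //; exact: le_trans ler01 (ge1 x m).
  apply: le_trans (QD x) _; rewrite mulrCA; apply: ler_peMl => //.
  by apply: mulr_ge0 => //; exact: le_trans ler01 (ge1 x k).
- exists (C * D), (m + k)%N => x.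
  by rewrite [(P * Q) x]/(P x * Q x) normrM exprD mulrACA ler_pM.
Qed.

(** After extraction of an $(N+1)$-th root the exponential only has to beat
    $1 + y$, for which $1 + u \le e^u$ suffices; the root of order $N + 1$
    rather than $N$ covers $N = 0$. *)
Lemma pow_gauss_bounded (a : R) N : 0 < a ->
  exists M, forall y : R, 0 <= y -> (1 + y) ^+ N * expR (- a * y ^+ 2) <= M.
Proof.
move=> a0; pose m : R := N.+1%:R; have m0 : 0 < m by rewrite ltr0n.
(* K makes K (1 + a y^2 / m) at least 2 + y^2, hence at least 1 + y *)
pose K := 2 + m / a.
exists (K ^+ N.+1) => y y0.
rewrite mulNr expRN ler_pdivrMr ?expR_gt0//.
have -> : a * y ^+ 2 = (a / m * y ^+ 2) * N.+1%:R.
  by rewrite -/m; field; rewrite gt_eqF.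
rewrite expRM_natr -exprMn.
have y1 : 1 <= 1 + y by rewrite lerDl.
apply: (@le_trans _ _ ((1 + y) ^+ N.+1)); first by rewrite ler_weXn2l.
have K0 : 0 <= K by rewrite addr_ge0// divr_ge0 ?ltW.
apply: lerXn2r; rewrite ?nnegrE.
- exact: le_trans ler01 y1.
- by rewrite mulr_ge0// expR_ge0.
apply: (@le_trans _ _ (K * (1 + a / m * y ^+ 2))); last first.
  by rewrite ler_wpM2l// expR_ge1Dx.
have -> : K * (1 + a / m * y ^+ 2) = 2 + m / a + 2 * (a / m * y ^+ 2) + y ^+ 2.
  by rewrite /K; field; rewrite !gt_eqF.
have h1 : 0 <= m / a by rewrite divr_ge0 ?ltW.
have h2 : 0 <= a / m * y ^+ 2 by rewrite mulr_ge0 ?sqr_ge0// divr_ge0 ?ltW.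
have h3 : y <= 1 + y ^+ 2 by nra.
by move: (m / a) (a / m * y ^+ 2) h1 h2 => u v; lra.
Qed.

Definition gauss_rV (a : R) (x : 'rV[R]_n) : R := expR (- a * dot_rV x x).

Lemma polyfun_dot (a : R) : polyfun (fun x => - a * dot_rV x x).
Proof.
rewrite (_ : (fun x => _) = (fun=> - a) *
  (\sum_(i < n) (fun x : 'rV[R]_n => x ord0 i * x ord0 i))).
  apply: polyfunM; first exact: polyfun_cst.
  elim: (index_enum _) => [|i s IH].
    by rewrite big_nil; exact: polyfun_cst.
  rewrite big_cons; apply: polyfunD => //.
  by apply: (polyfunM (polyfun_coord i) (polyfun_coord i)).
by apply/funext => x; rewrite /dot_rV [RHS]/(_ * _) fct_sumE.
Qed.

Lemma differentiable_gauss_rV a x : differentiable (gauss_rV a) x.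
Proof.
apply: differentiable_comp; first exact: differentiable_polyfun (polyfun_dot a).
by apply/derivable1_diffP; exact: derivable_expR.
Qed.

Lemma derive_gauss_rV a v x :
  'D_v (gauss_rV a) x = 'D_v (fun x => - a * dot_rV x x) x * gauss_rV a x.
Proof.
have dq := differentiable_polyfun x (polyfun_dot a).
have de : differentiable (@expR R) (- a * dot_rV x x).
  by apply/derivable1_diffP; exact: derivable_expR.
rewrite deriveE; last exact: differentiable_gauss_rV.
rewrite /gauss_rV [X in 'd X x](_ : _ = expR \o (fun x => - a * dot_rV x x))//.
rewrite diff_comp//= diff1E// -deriveE// derive1E.
by have [_ ->] := is_derive_expR (- a * dot_rV x x).
Qed.

Lemma schwartz_real_gauss a : 0 < a -> schwartz_real (gauss_rV a).
Proof.
move=> a0.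
have partialE s : exists2 P, polyfun P &
    partial_rV s (gauss_rV a) = P * gauss_rV a.
  elim: s => [|i s [P pP IH]].
    exists (fun=> 1); first exact: polyfun_cst.
    by apply/funext => x; rewrite /= [RHS]mul1r.
  exists ('D_(delta_mx ord0 i) P +
      P * 'D_(delta_mx ord0 i) (fun x => - a * dot_rV x x)).
    apply: polyfunD; first exact: polyfun_derive.
    by apply: polyfunM => //; apply: polyfun_derive; exact: polyfun_dot.
  apply/funext => x; rewrite /= IH deriveM; last 2 first.
  - by apply: diff_derivable; exact: differentiable_polyfun.
  - by apply: diff_derivable; exact: differentiable_gauss_rV.
  rewrite derive_gauss_rV -[RHS]/((_ + _ * _) * gauss_rV a x) /GRing.scale/=.
  by ring.
split=> [s x|s k].
  have [P pP ->] := partialE s.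
  apply: differentiableM; last exact: differentiable_gauss_rV.
  exact: differentiable_polyfun.
have [P pP ->] := partialE s.
have [C [m PC]] := polyfun_growth pP.
have [M MP] := pow_gauss_bounded (k + m) a0.
have C0 : 0 <= C.
  by have := le_trans (normr_ge0 _) (PC 0); rewrite normr0 addr0 expr1n mulr1.
exists (C * M) => x.
rewrite -[(P * _) x]/(P x * gauss_rV a x) normrM (ger0_norm (expR_ge0 _)).
apply: (@le_trans _ _ (C * ((1 + `|x|) ^+ (k + m) * expR (- a * `|x| ^+ 2)))).
  rewrite exprD [leLHS]mulrA [leRHS]mulrA; apply: ler_pM.
  - by rewrite mulr_ge0// exprn_ge0.
  - exact: expR_ge0.
  - rewrite mulrCA; apply: ler_pM => //.
    by apply: lerXn2r; rewrite ?nnegrE ?addr_ge0// lerDr.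
  - by rewrite ler_expR !mulNr lerN2 ler_wpM2l ?ler_sqr_norm_dot// ltW.
by rewrite ler_wpM2l// MP.
Qed.

Lemma schwartz_gauss a : 0 < a ->
  schwartz (fun x => real_complex R (gauss_rV a x)).
Proof.
move=> a0; split; first exact: schwartz_real_gauss.
have p0 (s : seq 'I_n) : partial_rV s (fun x : 'rV[R]_n => 0 : R) = (fun=> 0).
  by elim: s => //= i s ->; apply/funext => x; rewrite derive_cst.
split=> [s x|s k]; rewrite p0; first exact: differentiable_cst.
by exists 0 => x; rewrite normr0 mulr0.
Qed.

End gaussian_schwartz.

(** * Lower bounds of Lebesgue norms *)

Section Lnorm_bounds.
Context d (T : measurableType d) (R : realType).
Variable mu : {measure set T -> \bar R}.

(** The simple function $c 1_{A \setminus N}$, with $N$ the exceptional null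
    set, lies below [f] everywhere, and the integral of [f] is the supremum of
    the integrals of such functions. *)
Lemma ge0_integral_ge_cst (f : T -> \bar R) (A : set T) (c : R) :
  (0 <= c) -> measurable A -> mu A = 1%E -> (forall x, 0 <= f x)%E ->
  {ae mu, forall x, A x -> (c%:E <= f x)%E} -> (c%:E <= \int[mu]_x f x)%E.
Proof.
move=> c0 mA muA f0 [N [mN muN fN]].
have mAN : measurable (A `\` N) by exact: measurableD.
have muAN : mu (A `\` N) = 1%E.
  have muAoo : (mu A < +oo)%E by rewrite muA ltry.
  rewrite measureD//.
  rewrite [X in (_ - X)%E](_ : _ = 0%E) ?sube0//.
  apply/eqP; rewrite eq_le measure_ge0 andbT -muN.
  by apply: le_measure; rewrite ?inE//; exact: measurableI.
have -> : c%:E = (\int[mu]_x (c * \1_(A `\` N) x)%:E)%E.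
  under eq_integral do rewrite EFinM.
  rewrite ge0_integralZl//.
  - by rewrite integral_indic// setIT muAN mule1.
  - by apply/measurable_EFinP; exact: measurable_indic.
rewrite (integralT_nnsfun _ (scale_nnsfun (indic_nnsfun R mAN) c0)).
rewrite ge0_integralTE//; apply: ereal_sup_ubound.
exists (scale_nnsfun (indic_nnsfun R mAN) c0) => // x.
rewrite -[leLHS]/((c * \1_(A `\` N) x)%:E) indicE.
case: (boolP (x \in A `\` N)) => [|_]; rewrite /= ?mulr1 ?mulr0//.
rewrite inE => -[Ax nNx]; apply: contrapT => cfx; apply: nNx; apply: fN => /= H.
by apply: cfx; exact: H.
Qed.

(** Used for $t \mapsto \|\psi_t\|_q$ on a time interval of length one. *)
Lemma Lnorm_ge_cst (f : T -> \bar R) (A : set T) (p : \bar R) (c : R) :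
  (1 <= p)%E -> 0 <= c -> measurable A -> mu A = 1%E ->
  {ae mu, forall x, A x -> (c%:E <= f x)%E} -> (c%:E <= Lnorm mu p f)%E.
Proof.
move=> p1 c0 mA muA fc; rewrite unlock /Lnorm; case: p p1 => [p||//] p1.
- rewrite lee_fin in p1.
  have p0 : (0 < p)%R by rewrite (lt_le_trans _ p1).
  rewrite (_ : c%:E = ((c `^ p)%:E `^ p^-1)%E); last first.
    by rewrite poweR_EFin -powRrM mulfV ?powRr1// gt_eqF.
  apply: gt0_ler_poweR; rewrite ?in_itv/= ?leey ?andbT ?invr_ge0 ?lee_fin
    ?powR_ge0 ?(ltW p0)//.
    by apply: integral_ge0 => x _; exact: poweR_ge0.
  apply: (ge0_integral_ge_cst _ mA) => //; first exact: powR_ge0.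
    by move=> x; exact: poweR_ge0.
  apply: filterS fc => x fx /fx cx; rewrite -poweR_EFin.
  have := le_trans cx (lee_abs _); have := abse_ge0 (f x).
  move=> ? ?; apply: gt0_ler_poweR;
    by rewrite ?in_itv/= ?leey ?andbT ?lee_fin ?(ltW p0).
- have muT : (0 < mu setT)%E.
    rewrite (@lt_le_trans _ _ (mu A))//; first by rewrite muA.
    by apply: le_measure; rewrite ?inE.
  rewrite muT leNgt; apply/negP => lec.
  have [N [mN muN fN]] : {ae mu, forall x, ~ A x}.
    apply: filterS2 fc (ess_sup_ge mu (abse \o f)) => x fx xle /fx cx.
    have := le_lt_trans (le_trans (le_trans cx (lee_abs _)) xle) lec.
    by rewrite ltxx.
  have : (mu A <= mu N)%E.
    by apply: le_measure; rewrite ?inE// => x Ax; apply: fN => /=; exact.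
  by rewrite muN muA lee_fin ler10.
Qed.

(** Hoelder's inequality against a fixed weight, which belongs to all Lebesgue
    spaces since it is bounded and integrable. *)
Lemma integral_weight_le (q : \bar R) (h : T -> R) :
  (1 <= q)%E -> (forall x, 0 <= h x <= 1) ->
  mu.-integrable setT (fun x => (h x)%:E) ->
  exists2 K : R, 0 < K &
  forall g : T -> R, measurable_fun setT g -> (forall x, 0 <= g x) ->
    (\int[mu]_x (g x * h x)%:E <= Lnorm mu q (fun x => (g x)%:E) * K%:E)%E.
Proof.
move=> q1 h01 ih.
have mh : measurable_fun setT h.
  by apply/measurable_EFinP; exact: measurable_int ih.
have h0 x : 0 <= h x by have /andP[] := h01 x.
have h1 x : h x <= 1 by have /andP[] := h01 x.
have fin := integrable_fin_num measurableT ih.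
case: q q1 => [q||//] q1.
- rewrite lee_fin in q1.
  have [q1'|q1'] := eqVneq q 1.
    exists 1 => // g mg g0; rewrite q1' Lnorm1 mule1.
    apply: ge0_le_integral => //.
    - by move=> x _; rewrite lee_fin mulr_ge0.
    - by apply/measurable_EFinP; exact: measurable_funM.
    - by apply/measurable_EFinP; apply: measurableT_comp.
    - by move=> x _; rewrite lee_fin ger0_norm// ler_piMr.
  have q0 : 0 < q by rewrite (lt_le_trans _ q1).
  have q1s : 1 < q by rewrite lt_neqAle eq_sym q1'.
  (* the conjugate exponent *)
  pose q' := (1 - q^-1)^-1.
  have q'0 : 0 < q' by rewrite invr_gt0 subr_gt0 invf_lt1.
  have fin' : Lnorm mu q'%:E (fun x => (h x)%:E) \is a fin_num.
    rewrite unlock /Lnorm; apply: fin_num_poweR.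
    have : mu.-integrable setT (fun x => `|(h x)%:E| `^ q')%E.
      have q'1 : 1 <= q'.
        by rewrite invf_ge1 ?subr_gt0 ?invf_lt1// lerBlDr lerDl invr_ge0 ltW.
      apply: le_integrable ih => //.
        apply: (@measurableT_comp _ _ _ _ _ _ (fun x => x `^ q')%E).
          exact: measurable_poweR.
        by apply: measurableT_comp => //; exact/measurable_EFinP.
      move=> x _; rewrite /= lee_fin !ger0_norm ?powR_ge0//.
      have [->|hx0] := eqVneq (h x) 0; first by rewrite powR0// gt_eqF.
      rewrite -[leRHS]powRr1//; apply: ger_powR => //.
      by rewrite h1 andbT lt_neqAle eq_sym hx0 h0.
    by move/(integrable_fin_num measurableT).
  exists (1 + fine (Lnorm mu q'%:E (fun x => (h x)%:E))).
    by rewrite ltr_pwDl// fine_ge0// Lnorm_ge0.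
  move=> g mg g0.
  have := @hoelder _ _ _ mu g h q q' mg mh q0 q'0.
  rewrite invrK addrC subrK => /(_ erefl).
  rewrite Lnorm1 => H.
  apply: (@le_trans _ _ (\int[mu]_x `|((g \* h) x)%:E|)%E).
    by under [leRHS]eq_integral do rewrite /= ger0_norm ?mulr_ge0//.
  apply: (le_trans H); apply: lee_wpmul2l; first exact: Lnorm_ge0.
  by rewrite EFinD (fineK fin') leeDr.
- exists (1 + fine (\int[mu]_x (h x)%:E)).
    by rewrite ltr_pwDl// fine_ge0// integral_ge0// => x _; rewrite lee_fin.
  move=> g mg g0; set N := Lnorm _ _ _.
  have N0 : (0 <= N)%E by exact: Lnorm_ge0.
  have aeN : {ae mu, forall x, (g x)%:E <= N}%E.
    rewrite /N unlock /Lnorm; case: ifPn => mu0.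
      apply: filterS (ess_sup_ge mu (abse \o (fun x => (g x)%:E))) => x.
      by rewrite /= ger0_norm.
    exists setT; split => //.
    by apply/eqP; rewrite eq_le measure_ge0 andbT leNgt.
  have [->|Nfin] := eqVneq N +oo%E.
    rewrite gt0_mulye ?leey// lte_fin ltr_pwDl// fine_ge0// integral_ge0//.
    by move=> x _; rewrite lee_fin.
  apply: (@le_trans _ _ (\int[mu]_x (N * (h x)%:E))%E).
    apply: ae_ge0_le_integral => //.
    - by move=> x _; rewrite lee_fin mulr_ge0.
    - by apply/measurable_EFinP; exact: measurable_funM.
    - by move=> x _; rewrite mule_ge0// lee_fin.
    - by apply: emeasurable_funM => //; exact/measurable_EFinP.
    - apply: filterS aeN => x gN _; rewrite EFinM; apply: lee_wpmul2r => //.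
      by rewrite lee_fin.
  have Nf : N \is a fin_num by rewrite ge0_fin_numE// ltey.
  rewrite -(fineK Nf) integralZl//; apply: lee_wpmul2l; first by rewrite fineK.
  by rewrite EFinD (fineK fin) leeDr.
Qed.

End Lnorm_bounds.

(** * Schroedinger evolution of Gaussians *)

Section gaussian_propagation.
Variables (R : realType).
Local Notation "x %:C" := (real_complex R x).
Local Notation i := (Complex 0 1 : R[i]).
Implicit Types (w : R[i]) (s t : R).

Lemma cgaussM w w' x x' (y : R) :
  cgauss w x y * cgauss w' x' y = cgauss (w + w') (x + x') y.
Proof.
rewrite /cgauss -cexpD; congr cexp.
by rewrite [(x + x') * y]mulrDl rmorphD; ring.
Qed.

Lemma Re_invC w : Re w^-1 = Re w / normc w ^+ 2.
Proof. by rewrite sqr_normc; case: w. Qed.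

Lemma normc_gt0 w : w != 0 -> 0 < normc w.
Proof.
move=> w0; rewrite lt_neqAle normc_ge0 andbT eq_sym.
by apply: contra_neq w0; exact: ComplexField.Normc.eq0_normc.
Qed.

Lemma Re_inv_gt0 w : 0 < Re w -> 0 < Re w^-1.
Proof.
move=> w0; rewrite Re_invC divr_gt0// exprn_gt0// normc_gt0//.
exact: Re_gt0_neq0.
Qed.

Lemma Re_quarter_inv w : Re (4 * w)^-1 = Re w^-1 / 4.
Proof.
have -> : (4 * w)^-1 = (4^-1)%:C * w^-1 by rewrite invfM fmorphV rmorph_nat.
by rewrite ReM /= mul0r subr0 mulrC.
Qed.

Section dimension.
Variable n : nat.
Implicit Types x y xi : 'rV[R]_n.

Definition cgauss_rV w x y := \prod_(j < n) cgauss w (x ord0 j) (y ord0 j).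

Lemma cgauss_rVM w w' x x' y :
  cgauss_rV w x y * cgauss_rV w' x' y = cgauss_rV (w + w') (x + x') y.
Proof.
rewrite /cgauss_rV -big_split; apply: eq_bigr => j _ /=.
by rewrite cgaussM mxE.
Qed.

Lemma expi_cgauss_rV x y : expi (- dot_rV y x) = cgauss_rV 0 x y.
Proof.
rewrite expiE /cgauss_rV -cexp_sum; congr cexp.
have -> : Complex 0 (- dot_rV y x) = - i * (dot_rV y x)%:C.
  by apply: complex_ext; rewrite ?ReM ?ImM /=; ring.
rewrite /dot_rV rmorph_sum mulr_sumr; apply: eq_bigr => j _ /=.
by rewrite mul0r [y ord0 j * _]mulrC; ring.
Qed.

Lemma cgauss_rV0E w y : cgauss_rV w 0 y = cexp (- w * (dot_rV y y)%:C).
Proof.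
rewrite /cgauss_rV -cexp_sum; congr cexp.
rewrite /dot_rV rmorph_sum mulr_sumr; apply: eq_bigr => j _ /=.
by rewrite mxE mul0r rmorph0 expr2; ring.
Qed.

Lemma normc_cgauss_rV w x y :
  normc (cgauss_rV w x y) = expR (- Re w * dot_rV y y).
Proof.
rewrite /cgauss_rV normc_prod.
under eq_bigr do rewrite normc_cgauss.
rewrite -expR_sum; congr expR; rewrite /dot_rV mulr_sumr.
by apply: eq_bigr => j _; rewrite expr2.
Qed.

Lemma cintegrable_cgauss_rV w x : 0 < Re w ->
  cintegrable (lebesgue_rV R n) (cgauss_rV w x).
Proof.
move=> w0; by have [] := @cintegrable_rV_prod R n (fun j => cgauss w (x ord0 j))
  (fun j => cintegrable_cgauss _ w0).
Qed.

Lemma integral_cgauss_rV w x : 0 < Re w ->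
  integral_rV (cgauss_rV w x) = \prod_(j < n) gauss_int w (x ord0 j).
Proof.
move=> w0; by have [] := @cintegrable_rV_prod R n (fun j => cgauss w (x ord0 j))
  (fun j => cintegrable_cgauss _ w0).
Qed.

(** The plane wave is absorbed in the Gaussian, and the integral then factors
    into one-dimensional Fourier transforms. *)
Lemma fourier_cgauss_rV (c : R[i]) w xi : 0 < Re w ->
  fourier (fun y => c * cgauss_rV w 0 y) xi =
  c * gauss_int w 0 ^+ n * cgauss_rV (4 * w)^-1 0 xi.
Proof.
move=> w0; rewrite /fourier.
have -> : (fun y => expi (- dot_rV y xi) * (c * cgauss_rV w 0 y)) =
    (fun y => c * cgauss_rV w xi y).
  apply/funext => y; rewrite expi_cgauss_rV mulrCA cgauss_rVM.
  by rewrite add0r addr0.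
rewrite -[LHS]/(cintegral _ _) cintegralZ; last exact: cintegrable_cgauss_rV.
rewrite -mulrA; congr (_ * _).
rewrite -[LHS]/(integral_rV _) integral_cgauss_rV//.
under eq_bigr do rewrite gauss_intE//.
rewrite big_split /= prodr_const card_ord; congr (_ * _).
rewrite /cgauss_rV; apply: eq_bigr => j _; rewrite /cgauss; congr cexp.
by rewrite mxE mul0r rmorph0 mulr0 subr0 mulrC.
Qed.

Lemma inv_fourierE (f : 'rV[R]_n -> R[i]) x :
  inv_fourier f x = ((2 * pi) ^- n)%:C * fourier f (- x).
Proof.
rewrite /inv_fourier /fourier; congr (_ * integral_rV _); apply/funext => y.
congr (expi _ * _); rewrite /dot_rV -sumrN; apply: eq_bigr => j _.
by rewrite mxE mulrN opprK mulrC.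
Qed.

Lemma cgauss_rV_even w y : cgauss_rV w 0 (- y) = cgauss_rV w 0 y.
Proof.
rewrite !cgauss_rV0E; congr (cexp (_ * _%:C)); apply: eq_bigr => j _.
by rewrite mxE mulrNN.
Qed.

(** The propagator is moved onto the test function $e^{-|x|^2/4}$, whose inverse
    Fourier transform is a multiple of $e^{-|\xi|^2}$; the multiplier turns its
    width into $1 + it$, and the last Fourier transform into
    $1/(4(1 + it))$. *)
Lemma schrodinger_pairing z t : 0 < Re z ->
  schrodinger_propagator t (tempered_of (cgauss_rV z 0))
    (cgauss_rV (4^-1)%:C 0) =
  (((2 * pi)^-1)%:C * gauss_int (4^-1)%:C 0 * gauss_int (Complex 1 t) 0 *
    gauss_int (z + (4 * Complex 1 t)^-1) 0) ^+ n.
Proof.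
move=> z0.
rewrite /schrodinger_propagator /tempered_inv_fourier /tempered_mul
  /tempered_fourier.
pose c := ((2 * pi) ^- n)%:C * gauss_int (4^-1)%:C 0 ^+ n.
have -> : (fun xi => expi (- (t * dot_rV xi xi)) *
    inv_fourier (cgauss_rV (4^-1)%:C 0) xi) =
    (fun xi => c * cgauss_rV (Complex 1 t) 0 xi).
  apply/funext => xi; rewrite inv_fourierE.
  have -> : cgauss_rV (4^-1)%:C 0 = (fun y => 1 * cgauss_rV (4^-1)%:C 0 y).
    by apply/funext => y; rewrite mul1r.
  rewrite fourier_cgauss_rV/= ?invr_gt0// mul1r cgauss_rV_even.
  have -> : expi (- (t * dot_rV xi xi)) = cgauss_rV (Complex 0 t) 0 xi.
    rewrite expiE cgauss_rV0E; congr cexp.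
    by apply: complex_ext; rewrite ?ReM ?ImM /=; ring.
  have -> : (4 * (4^-1)%:C)^-1 = 1 :> R[i].
    by rewrite fmorphV rmorph_nat divff ?invr1// pnatr_eq0.
  have -> : Complex 1 t = Complex 0 t + 1.
    by apply: complex_ext; rewrite /= ?add0r ?addr0.
  rewrite -[in RHS](addr0 (0 : 'rV[R]_n)) -cgauss_rVM /c.
  by move: (cgauss_rV (Complex 0 t) _ _) (cgauss_rV 1 _ _) => u v; ring.
have wt0 : 0 < Re (Complex 1 t) by rewrite /= ltr01.
rewrite (funext (fun x => fourier_cgauss_rV c x wt0)) /tempered_of.
pose b := c * gauss_int (Complex 1 t) 0 ^+ n.
have -> : (fun x => cgauss_rV z 0 x *
    (b * cgauss_rV (4 * Complex 1 t)^-1 0 x)) =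
    (fun x => b * cgauss_rV (z + (4 * Complex 1 t)^-1) 0 x).
  by apply/funext => x; rewrite mulrCA cgauss_rVM addr0.
have v0 : 0 < Re (z + (4 * Complex 1 t)^-1).
  by rewrite ReD Re_quarter_inv addr_gt0// divr_gt0// Re_inv_gt0.
rewrite -[LHS]/(cintegral _ _) cintegralZ; last exact: cintegrable_cgauss_rV.
rewrite -[cintegral _ _]/(integral_rV _) integral_cgauss_rV//.
under eq_bigr do rewrite mxE.
have cE : ((2 * pi) ^- n)%:C = ((2 * pi)^-1)%:C ^+ n :> R[i].
  by rewrite -[RHS]rmorphXn /= exprVn.
by rewrite prodr_const card_ord /b /c cE !exprMn.
Qed.

End dimension.
End gaussian_propagation.

(** * The focusing Gaussians *)

Section counterexample.
Variables (R : realType) (n : nat).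
Local Notation "x %:C" := (real_complex R x).
Implicit Types s t : R.

(** $e^{-|x|^2/(4(1 - is))}$: the free evolution adds $it$ to $1 - is$, so that
    the Gaussian has real width exactly at time $s$. *)
Definition focusing_gauss s : 'rV[R]_n -> R[i] :=
  cgauss_rV (4 * Complex 1 (- s))^-1 0.

Lemma Re_focusing s :
  Re (4 * Complex 1 (- s))^-1 = (4 * normc (Complex 1 (- s)) ^+ 2)^-1.
Proof. by rewrite Re_quarter_inv Re_invC div1r -invfM mulrC. Qed.

Lemma normc_1N_gt0 s : 0 < normc (Complex 1 (- s)).
Proof. by apply: normc_gt0; apply: Re_gt0_neq0; rewrite /= ltr01. Qed.

Lemma Re_focusing_gt0 s : 0 < Re (4 * Complex 1 (- s))^-1.
Proof.
by rewrite Re_focusing invr_gt0 mulr_gt0// exprn_gt0// normc_1N_gt0.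
Qed.

(** With $u = 1 - is$ and $v = 1 + it$, the pairing is $a^n$ where
    $|a|^2 = 4\pi |u| / |u + v|$: the factors $|v|$ cancel, and
    $|u + v| = |2 + i(t - s)|$ depends on $t - s$ alone.  Both sides
    are squared because only squares of the Gaussian integrals are rational in
    the widths. *)
Lemma focusing_pairing_ge s t : s <= t <= s + 1 ->
  normc (Complex 1 (- s)) ^+ n <=
  normc (schrodinger_propagator t (tempered_of (focusing_gauss s))
    (cgauss_rV (4^-1)%:C 0)) ^+ 2.
Proof.
move=> /andP[st ts].
rewrite schrodinger_pairing ?Re_focusing_gt0// normcX -exprM mulnC exprM.
set u := Complex 1 (- s); set v := Complex 1 t.
have u0 : 0 < normc u by exact: normc_1N_gt0.
have wn0 : v != 0 by apply: Re_gt0_neq0; rewrite /= ltr01.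
have un0 : u != 0 by apply: Re_gt0_neq0; rewrite /= ltr01.
have v0 : 0 < normc v by exact: normc_gt0.
set z := (4 * u)^-1 + (4 * v)^-1.
have Rez : 0 < Re z.
  rewrite ReD addr_gt0 ?Re_focusing_gt0// Re_quarter_inv divr_gt0//.
  by rewrite Re_inv_gt0//= ltr01.
have z0 : 0 < normc z by apply: normc_gt0; exact: Re_gt0_neq0.
have zE : normc z * (4 * normc u * normc v) = normc (u + v).
  have -> : 4 * normc u * normc v = normc (4 * u * v).
    rewrite !ComplexField.Normc.normcM; congr (_ * _ * _).
    by rewrite -[4 in RHS](rmorph_nat (real_complex R)) normc_real ger0_norm.
  rewrite -ComplexField.Normc.normcM; congr normc.
  by rewrite /z; field; rewrite un0 wn0.
have uv3 : normc (u + v) <= 3.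
  rewrite -(@ler_pXn2r _ 2) ?nnegrE ?normc_ge0// sqr_normc /u /v /=.
  nra.
have h4 : normc (gauss_int (4^-1)%:C 0) ^+ 2 * 4^-1 = pi.
  have := @normc_gauss_int0 R (4^-1)%:C.
  rewrite normc_real ger0_norm ?invr_ge0//.
  by apply; rewrite /= invr_gt0.
have ht : normc (gauss_int v 0) ^+ 2 * normc v = pi.
  by apply: normc_gauss_int0; rewrite /= ltr01.
have hz := normc_gauss_int0 Rez.
apply: lerXn2r; rewrite ?nnegrE ?sqr_ge0 ?(ltW u0)//.
rewrite !ComplexField.Normc.normcM !exprMn normc_real.
have p2 := @pi_ge2 R.
have p0 : 0 < pi :> R by exact: pi_gt0.
rewrite ger0_norm ?invr_ge0 ?mulr_ge0 ?(ltW p0)//.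
move: (normc (gauss_int (4^-1)%:C 0) ^+ 2) (normc (gauss_int v 0) ^+ 2)
  (normc (gauss_int z 0) ^+ 2) h4 ht hz => a b c h4 ht hz.
have -> : a = pi * 4 by rewrite -h4; field.
have -> : b = pi / normc v by rewrite -ht; field; rewrite gt_eqF.
have -> : c = pi / normc z by rewrite -hz; field; rewrite gt_eqF.
have -> : ((2 * pi)^-1) ^+ 2 * (pi * 4) * (pi / normc v) * (pi / normc z) =
    4 * pi * normc u / (normc z * (4 * normc u * normc v)).
  have := p0; move: (pi : R) => P P0.
  by field; rewrite (gt_eqF P0) (gt_eqF u0) (gt_eqF v0) (gt_eqF z0).
have uv0 : 0 < normc (u + v) by rewrite -zE !mulr_gt0.
rewrite zE ler_pdivlMr// mulrC ler_wpM2r ?(ltW u0)//.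
by apply: le_trans uv3 _; lra.
Qed.

(** The datum has modulus $e^{-|x|^2/(4S^2)}$ with $S = |1 - is|$, so that its
    norm is a multiple of $S^{n/r}$, where $n/r < n/2$; for $r = \infty$ it is
    at most $1$ and the exponent is $0$. *)
Lemma Lnorm_focusing_le (r : \bar R) : (0 < n)%N -> (2%:E < r)%E ->
  exists D e : R, [/\ 0 < D, e < n%:R / 2 & forall s,
  (Lnorm_rV r (focusing_gauss s) <=
    (D * normc (Complex 1 (- s)) `^ e)%:E)%E].
Proof.
move=> n0; case: r => [r||//] r2.
- rewrite lte_fin in r2; have r0 : 0 < r by lra.
  pose k := Num.sqrt (4 * pi / r).
  have k0 : 0 < k by rewrite sqrtr_gt0 divr_gt0// mulr_gt0// pi_gt0.
  exists ((k ^+ n) `^ r^-1), (n%:R / r); split.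
  + by rewrite powR_gt0// exprn_gt0.
  + by rewrite ltr_pM2l ?ltr0n// ltf_pV2 ?posrE.
  move=> s; set S := normc _; have S0 : 0 < S by exact: normc_1N_gt0.
  rewrite /Lnorm_rV unlock /Lnorm.
  pose a := r * Re (4 * Complex 1 (- s))^-1.
  have a0 : 0 < a by rewrite mulr_gt0// Re_focusing_gt0.
  have aE : Num.sqrt (pi / a) = S * k.
    rewrite /a Re_focusing -/S -[in RHS](ger0_norm (ltW S0)) -sqrtr_sqr.
    rewrite -sqrtrM ?sqr_ge0//.
    congr Num.sqrt; move: (pi : R) => P.
    by field; rewrite (gt_eqF r0) (gt_eqF S0).
  have [ir _] := @cintegrable_cgauss_rV R n a%:C 0 a0.
  have -> : (\int[lebesgue_rV R n]_x
      `|(normc (focusing_gauss s x))%:E| `^ r)%E =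
      (\int[lebesgue_rV R n]_x (Re (cgauss_rV a%:C 0 x))%:E)%E.
    apply: eq_integral => x _.
    rewrite cgauss_rV0E -rmorphN -rmorphM cexp_real /=.
    rewrite ger0_norm ?normc_ge0// normc_cgauss_rV /a; congr EFin.
    by rewrite -expRM; congr expR; ring.
  rewrite -(fineK (integrable_fin_num measurableT ir)).
  have -> : fine (\int[lebesgue_rV R n]_x (Re (cgauss_rV a%:C 0 x))%:E)%E =
      (S * k) ^+ n.
    transitivity (Re (integral_rV (@cgauss_rV R n a%:C 0))); first by [].
    rewrite integral_cgauss_rV//; under eq_bigr do rewrite mxE gauss_int_real//.
    by rewrite prodr_const card_ord -rmorphXn /= aE.
  rewrite poweR_EFin lee_fin exprMn powRM ?exprn_ge0 ?(ltW S0) ?(ltW k0)//.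
  by rewrite [leRHS]mulrC powRrM powR_mulrn// ltW.
- exists 1, 0; split => //; first by rewrite divr_gt0// ltr0n.
  move=> s; rewrite powRr0 mulr1 /Lnorm_rV unlock /Lnorm; case: ifPn => // _.
  apply/ess_supP; apply: aeW => x /=.
  rewrite lee_fin ger0_norm ?normc_ge0// normc_cgauss_rV expR_le1.
  by rewrite mulNr oppr_le0 mulr_ge0 ?dot_rV_ge0// ltW// Re_focusing_gt0.
Qed.

Lemma Lfun_focusing (r : \bar R) s : (0 < n)%N -> (2%:E < r)%E ->
  Lfun_rV r (focusing_gauss s).
Proof.
move=> n0 r2.
have [mr mi] := cintegrable_cmeasurable
  (@cintegrable_cgauss_rV R n _ 0 (Re_focusing_gt0 s)).
split => //.
have [D [e [_ _ H]]] := Lnorm_focusing_le n0 r2.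
exact: le_lt_trans (H s) (ltry _).
Qed.

(** Duality with the Schwartz function $e^{-|x|^2/4}$ bounds the spatial norm
    from below on a time interval of length one. *)
Lemma tempered_mixed_norm_focusing_ge (p q : \bar R) :
  (1 <= p)%E -> (1 <= q)%E ->
  exists2 K : R, 0 < K & forall s,
  ((K * normc (Complex 1 (- s)) `^ (n%:R / 2))%:E <=
    tempered_mixed_norm p q
      (fun t => schrodinger_propagator t (tempered_of (focusing_gauss s))))%E.
Proof.
move=> p1 q1.
have quarter0 : 0 < 4^-1 :> R by rewrite invr_gt0.
pose h : 'rV[R]_n -> R := gauss_rV 4^-1.
have etaE x : cgauss_rV (4^-1)%:C 0 x = (h x)%:C.
  by rewrite cgauss_rV0E -rmorphN -rmorphM cexp_real.
have h01 x : 0 <= h x <= 1.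
  by rewrite expR_ge0 expR_le1 mulNr oppr_le0 mulr_ge0 ?invr_ge0 ?dot_rV_ge0.
have ih : (lebesgue_rV R n).-integrable setT (fun x => (h x)%:E).
  have [+ _] := @cintegrable_cgauss_rV R n (4^-1)%:C 0 quarter0.
  by rewrite (funext etaE).
have [K K0 HK] := integral_weight_le q1 h01 ih.
exists K^-1; first by rewrite invr_gt0.
move=> s; set S := normc _; have S0 : 0 < S by exact: normc_1N_gt0.
apply: le_ereal_inf_tmp => _ [psi [[aeL _ _] aeT] <-].
rewrite /mixed_norm.
apply: (@Lnorm_ge_cst _ _ _ (@lebesgue_measure R)
  (fun t => Lnorm_rV q (psi t)) [set` `[s, s + 1]] p _ p1).
- by rewrite mulr_ge0 ?powR_ge0// invr_ge0 ltW.
- exact: measurable_itv.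
- apply: (etrans (lebesgue_measure_itv _)) => /=.
  by rewrite lte_fin ltrDl ltr01 -EFinB addrAC subrr add0r.
move: aeL aeT; apply: (@filterS2 _ _ (ae_filter_ringOfSetsType _)).
move=> t [mr mi Loo] Tt /=; rewrite in_itv/= => st.
have {}Tt := Tt (cgauss_rV (4^-1)%:C 0).
have hs : schwartz (@cgauss_rV R n (4^-1)%:C 0).
  by rewrite (funext etaE); apply: schwartz_gauss; rewrite invr_gt0.
have := focusing_pairing_ge st; rewrite -(Tt hs).
rewrite /tempered_of -[integral_rV _]/(cintegral _ _) -/S.
set f := (fun x => psi t x * _).
have mg : measurable_fun setT (fun x => normc (psi t x)).
  by apply: measurable_normc; split.
have mh : measurable_fun setT h.
  by apply/measurable_EFinP; exact: measurable_int ih.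
have Hg := HK _ mg (fun x => normc_ge0 _).
have gfin : ((\int[lebesgue_rV R n]_x (normc (psi t x) * h x)%:E) < +oo)%E.
  apply: le_lt_trans Hg _; apply: lte_mul_pinfty; last exact: ltry.
  - exact: Lnorm_ge0.
  - by rewrite ge0_fin_numE; [exact: Loo|exact: Lnorm_ge0].
have nf x : normc (f x) = normc (psi t x) * h x.
  rewrite ComplexField.Normc.normcM etaE normc_real ger0_norm//.
  by have /andP[] := h01 x.
have intf : cintegrable (lebesgue_rV R n) f.
  apply: (@cintegrable_dominated _ _ _ _ _ (fun x => normc (psi t x) * h x)).
  - apply: cmeasurableM; first by split.
    by rewrite (funext etaE); exact: cmeasurable_real.
  - apply/integrableP; split.
      by apply/measurable_EFinP; exact: measurable_funM.
    under eq_integral => x _.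
      rewrite /= ger0_norm -?nf ?normc_ge0//.
      over.
    rewrite (eq_integral (fun x => (normc (psi t x) * h x)%:E))// => x _.
    by rewrite nf.
  - by move=> x; rewrite nf.
have le1 := normc_cintegral_le intf.
rewrite (eq_integral _ _ (fun x _ => congr1 EFin (nf x))) in le1.
have le2 := le_trans le1 Hg.
move=> Sle.
have Sle' : S `^ (n%:R / 2) <= normc (cintegral (lebesgue_rV R n) f).
  rewrite -(@ler_pXn2r _ 2) ?nnegrE ?powR_ge0 ?normc_ge0//.
  apply: le_trans Sle; rewrite -powR_mulrn ?powR_ge0// -powRrM divfK//.
  by rewrite powR_mulrn// ltW.
rewrite -(@lee_pmul2r _ K%:E) ?lte_fin// -EFinM mulrAC mulVf ?gt_eqF// mul1r.
by apply: le_trans le2; rewrite lee_fin.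
Qed.

End counterexample.

Theorem theorem1 (R : realType) (n : nat) (p q r : \bar R) :
  (2 <= n)%N -> (1 <= p)%E -> (1 <= q)%E -> (2%:E < r)%E ->
  ~ exists C : R, 0 < C /\
      forall phi : 'rV[R]_n -> R[i], Lfun_rV r phi ->
        (tempered_mixed_norm p q
           (fun t => schrodinger_propagator t (tempered_of phi))
         <= C%:E * Lnorm_rV r phi)%E.
Proof.
move=> n2 p1 q1 r2 [C [C0 HC]].
have n0 : (0 < n)%N by exact: leq_trans n2.
have [D [e [D0 en HD]]] := Lnorm_focusing_le n0 r2.
have [K K0 HK] := tempered_mixed_norm_focusing_ge n p1 q1.
pose delta := n%:R / 2 - e; have d0 : 0 < delta by rewrite subr_gt0.
have CE0 : (0 <= C%:E)%E by rewrite lee_fin ltW.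
have bnd s : normc (Complex 1 (- s)) `^ delta <= C * D / K.
  have S0 := normc_1N_gt0 s.
  have := le_trans (HK s) (le_trans (HC _ (Lfun_focusing s n0 r2))
    (lee_wpmul2l CE0 (HD s))).
  rewrite -EFinM lee_fin mulrA => H.
  rewrite ler_pdivlMr// mulrC powRB; last by apply/implyP => _; rewrite gt_eqF.
  by rewrite mulrA ler_pdivrMr// powR_gt0.
pose M := C * D / K + 1.
have M0 : 0 < M by rewrite addr_gt0// divr_gt0// mulr_gt0.
(* this s is large enough for |1 - is| ^ delta to reach M *)
have := bnd (M `^ delta^-1); apply/negP; rewrite -ltNge.
apply: (@lt_le_trans _ _ M); first by rewrite ltrDl.
rewrite -[leLHS](_ : (M `^ delta^-1) `^ delta = M); last first.
  by rewrite -powRrM mulVf ?gt_eqF// powRr1// ltW.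
apply: ge0_ler_powR; rewrite ?nnegrE ?powR_ge0 ?normc_ge0 ?(ltW d0)//.
apply: le_trans (ler_Im_normc _); rewrite /= normrN.
exact: ler_norm.
Qed.
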